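(* Consider a finite-space SSP game (as in the context) satisfying the Finite-Space SSP Game Model Assumption, and the Q-learning algorithm described in the context, and suppose algorithmic conditions (i)–(v) hold. Then for any given initial $Q_0$, the sequence $\{Q_t\}$ generated by the Q-learning algorithm converges with probability 1 to the unique solution $Q^*$ of the equation $Q=FQ$.
   Context: Finite-space game: $S=\{1,\dots,n\}$, $S_o=S\cup\{0\}$, $0$ absorbing cost-free termination state. At $i\in S$, players I and II have finite control sets $U(i),V(i)$; under $(u,v)$ the state moves to $j\in S_o$ w.p. $p_{ij}(u,v)$ with (deterministic, real) transition cost $\hat g(i,u,v,j)$ paid by player I to player II; $g(i,u,v)$ is the expected one-stage cost. $J(i;\pi_1,\pi_2)=\liminf_{t\to\infty}E_{\pi_1\pi_2}[\sum_{k=0}^t\hat g(i_k,u_k,v_k,i_{k+1})\mid i_0=i]$ for history-dependent randomized policies. $\bar U(i)=\mathcal P(U(i))$, $\bar V(i)=\mathcal P(V(i))$; $\Pi_{1,SR},\Pi_{2,SR}$: stationary randomized policies. A pair of policies is prolonging if for some initial state the termination state is with positive probability never reached. Finite-Space SSP Game Model Assumption: (i) there is $\bar\mu\in\Pi_{1,SR}$ with $J(i;\bar\mu,\nu)<+\infty$ for all $\nu\in\Pi_{2,SR}$, all $i$; (ii) there is $\bar\nu\in\Pi_{2,SR}$ with $J(i;\mu,\bar\nu)>-\infty$ for all $\mu\in\Pi_{1,SR}$, all $i$; (iii) every prolonging pair in $\Pi_{1,SR}\times\Pi_{2,SR}$ has $J(i;\mu,\nu)\in\{+\infty,-\infty\}$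 for some $i$. $R=\{(i,u,v):i\in S,u\in U(i),v\in V(i)\}$; $U(0)=V(0)=\{0\}$, Q-factor vectors indexed by $R\cup\{(0,0,0)\}$ with $Q(0,0,0)=0$. $\underline Q(s,\rho,\sigma)=\sum_{\tilde u,\tilde v}\rho(\tilde u)\sigma(\tilde v)Q(s,\tilde u,\tilde v)$. $F$: $(FQ)(i,u,v)=g(i,u,v)+\sum_{j\in S}p_{ij}(u,v)\inf_{\rho\in\bar U(j)}\sup_{\sigma\in\bar V(j)}\underline Q(j,\rho,\sigma)$. Q-learning: on $(\Omega,\mathcal F,\mathbf P)$ with filtration $\{\mathcal F_t\}$; for each $t$ and $\ell=(i,u,v)\in R$, stepsize $\gamma_{t,\ell}\in[0,1]$, delays $0\le\tau_{\ell\tilde\ell}(t)\le t$, successor $j_t^\ell\in S_o$; with $Q_t^{(\ell)}(\tilde\ell)=Q_{\tau_{\ell\tilde\ell}(t)}(\tilde\ell)$ and $s=j_t^\ell$: $Q_{t+1}(i,u,v)=(1-\gamma_{t,\ell})Q_t(i,u,v)+\gamma_{t,\ell}\big(\hat g(i,u,v,s)+\inf_{\rho\in\bar U(s)}\sup_{\sigma\in\bar V(s)}\underline Q^{(\ell)}_t(s,\rho,\sigma)\big)$. Algorithmic conditions: (i) $Q_0$ is $\mathcal F_0$-measurable; (ii) $\gamma_{t,\ell},\tau_{\ell\tilde\ell}(t)$ are $\mathcal F_t$-measurable; (iii) $j_t^\ell$ is $\mathcal F_{t+1}$-measurable with $\mathbf P(j_t^\ell=j\mid\mathcal F_t)=p_{ij}(u,v)$;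 (iv) w.p.1 $\tau_{\ell\tilde\ell}(t)\to\infty$ for all $\ell,\tilde\ell$; (v) w.p.1 $\sum_t\gamma_{t,\ell}=\infty$, $\sum_t\gamma_{t,\ell}^2<\infty$ for all $\ell$. *)

(* Defs.v *)
From HB Require Import structures.
From mathcomp Require Import all_boot all_order all_algebra.
From mathcomp Require Import all_classical all_reals all_analysis.
Set Implicit Arguments. Unset Strict Implicit. Unset Printing Implicit Defensive.
Import Order.TTheory GRing.Theory Num.Theory.
Import numFieldNormedType.Exports.
Local Open Scope classical_set_scope.
Local Open Scope ring_scope.

(* States S = 'I_n (the paper's {1..n}); S_o = option 'I_n with None = the
   termination state 0.  U i, V i : finite control sets of the two players. *)

Definition SA (n : nat) (U V : 'I_n -> finType) : finType :=
  {i : 'I_n & (U i * V i)%type}.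

Definition triple (n : nat) (U V : 'I_n -> finType) (i : 'I_n) (u : U i) (v : V i)
  : SA U V := existT (fun i => (U i * V i)%type) i (u, v).

Definition is_dist (R : realType) (X : finType) (f : X -> R) : Prop :=
  (forall x, 0 <= f x) /\ \sum_(x : X) f x = 1.

Definition gexp (R : realType) (n : nat) (U V : 'I_n -> finType)
  (p ghat : SA U V -> option 'I_n -> R) (l : SA U V) : R :=
  \sum_(j : option 'I_n) p l j * ghat l j.

Definition bil (R : realType) (X Y : finType) (q : X -> Y -> R)
  (rho : X -> R) (sig : Y -> R) : R :=
  \sum_(x : X) \sum_(y : Y) rho x * sig y * q x y.

Definition infsup (R : realType) (X Y : finType) (q : X -> Y -> R) : R :=
  inf [set sup [set bil q rho sig | sig in [set s | @is_dist R Y s]]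
      | rho in [set r | @is_dist R X r]].

Definition mmval (R : realType) (n : nat) (U V : 'I_n -> finType)
  (q : SA U V -> R) (j : option 'I_n) : R :=
  match j with
  | Some s => infsup (fun (u : U s) (v : V s) => q (triple u v))
  | None => 0
  end.

Definition Fop (R : realType) (n : nat) (U V : 'I_n -> finType)
  (p ghat : SA U V -> option 'I_n -> R) (q : SA U V -> R) : SA U V -> R :=
  fun l => gexp p ghat l + \sum_(j : 'I_n) p l (Some j) * mmval q (Some j).

Definition is_srpolU (R : realType) (n : nat) (U : 'I_n -> finType)
  (mu : forall i : 'I_n, U i -> R) : Prop := forall i, is_dist (mu i).

Definition Pmn (R : realType) (n : nat) (U V : 'I_n -> finType)
  (p : SA U V -> option 'I_n -> R)
  (mu : forall i : 'I_n, U i -> R) (nu : forall i : 'I_n, V i -> R)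
  (i j : 'I_n) : R :=
  \sum_(u : U i) \sum_(v : V i) mu i u * nu i v * p (triple u v) (Some j).

Definition gmn (R : realType) (n : nat) (U V : 'I_n -> finType)
  (p ghat : SA U V -> option 'I_n -> R)
  (mu : forall i : 'I_n, U i -> R) (nu : forall i : 'I_n, V i -> R)
  (i : 'I_n) : R :=
  \sum_(u : U i) \sum_(v : V i) mu i u * nu i v * gexp p ghat (triple u v).

Fixpoint kstep (R : realType) (n : nat) (U V : 'I_n -> finType)
  (p : SA U V -> option 'I_n -> R)
  (mu : forall i : 'I_n, U i -> R) (nu : forall i : 'I_n, V i -> R)
  (k : nat) (i j : 'I_n) : R :=
  match k with
  | 0 => if i == j then 1 else 0
  | k'.+1 => \sum_(l : 'I_n) kstep p mu nu k' i l * Pmn p mu nu l j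
  end.

(* J(i; mu, nu) = liminf_t E[ sum_{k<=t} ghat(i_k,u_k,v_k,i_{k+1}) | i_0 = i ]
   for stationary randomized (mu, nu); the termination state is cost-free. *)
Definition Jsr (R : realType) (n : nat) (U V : 'I_n -> finType)
  (p ghat : SA U V -> option 'I_n -> R)
  (mu : forall i : 'I_n, U i -> R) (nu : forall i : 'I_n, V i -> R)
  (i : 'I_n) : \bar R :=
  limn_einf (fun t => ((\sum_(k < t.+1) \sum_(j : 'I_n)
                         kstep p mu nu k i j * gmn p ghat mu nu j)%R)%:E).

(* (mu, nu) is prolonging: for some initial state, termination is never
   reached with positive probability, i.e. P(i_k <> 0) (nonincreasing in k)
   stays bounded away from 0. *)
Definition prolonging (R : realType) (n : nat) (U V : 'I_n -> finType)
  (p : SA U V -> option 'I_n -> R)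
  (mu : forall i : 'I_n, U i -> R) (nu : forall i : 'I_n, V i -> R) : Prop :=
  exists i : 'I_n, exists2 eps : R, 0 < eps &
    forall k, eps <= \sum_(j : 'I_n) kstep p mu nu k i j.

Definition SSP_assumption (R : realType) (n : nat) (U V : 'I_n -> finType)
  (p ghat : SA U V -> option 'I_n -> R) : Prop :=
  [/\ (exists2 mu : forall i, U i -> R, is_srpolU mu &
         forall nu : forall i, V i -> R, is_srpolU nu ->
           forall i, (Jsr p ghat mu nu i < +oo)%E),
      (exists2 nu : forall i, V i -> R, is_srpolU nu &
         forall mu : forall i, U i -> R, is_srpolU mu ->
           forall i, (-oo < Jsr p ghat mu nu i)%E) &
      (forall (mu : forall i, U i -> R) (nu : forall i, V i -> R),
         is_srpolU mu -> is_srpolU nu -> prolonging p mu nu ->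
         exists i, Jsr p ghat mu nu i = +oo%E \/ Jsr p ghat mu nu i = -oo%E)].

Definition rmeas_wrt (d : measure_display) (T : measurableType d) (R : realType)
  (G : set (set T)) (f : T -> R) : Prop :=
  forall B : set R, measurable B -> G (f @^-1` B).

(* a random variable with countable (discrete) values is G-measurable *)
Definition dmeas_wrt (d : measure_display) (T : measurableType d) (X : Type)
  (G : set (set T)) (f : T -> X) : Prop :=
  forall x : X, G (f @^-1` [set x]).

(* P(E | G) = c (a.s.), i.e. P(A /\ E) = c P(A) for every A in G *)
Definition condprob_eq (d : measure_display) (T : measurableType d) (R : realType)
  (P : probability T R) (G : set (set T)) (E : set T) (c : R) : Prop :=
  forall A, G A -> P (A `&` E) = (c%:E * P A)%E.

(* Main.v *)
Require Import Defs.
From HB Require Import structures.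
From mathcomp Require Import all_boot all_order all_algebra.
From mathcomp Require Import ring lra.
From mathcomp Require Import all_classical all_reals all_analysis measurable_realfun.
Import Order.TTheory GRing.Theory Num.Theory.
Import numFieldNormedType.Exports.
Local Open Scope classical_set_scope.
Local Open Scope ring_scope.

(** A vector Z with F Z + e <= Z (e > 0) is an eventual upper bound of the
    iterates: replacing Q by Z in the sampled terms leaves a noise whose
    coefficients are deterministic, so that it is bounded and tends to 0 almost
    surely, and Q - Z - noise obeys a relaxation inequality with drift -e;
    this also yields boundedness.  Symmetrically, F Y >= Y + e gives an eventual
    lower bound.

    Such Y and Z exist: against the policy of assumption (ii), either the
    inequalities x_i + e <= g(i,u) + sum_j p_ij(u) x_j are solvable, or, by
    Farkas' lemma, there is a stationary occupation measure of nonpositive cost,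
    from which one builds a prolonging pair of bounded cost, contradicting (iii).
    The infimum of all strict supersolutions and the supremum of all strict
    subsolutions are fixed points of F; by the saddle points of the one-stage
    games two distinct fixed points would again produce a prolonging pair of
    finite cost, so both equal the unique fixed point and Q_t converges to it. *)

Set Implicit Arguments.
Unset Strict Implicit.
Unset Printing Implicit Defensive.

(** * Linear inequalities and matrix games *)

(** Prolonging pairs are allowed, so [Fop] need not contract any weighted norm. What remains is
    [shift_monotone]: raising the argument by at most c >= 0 raises the value by at most c. A
    comparison with the fixed point itself would then have drift zero and bound nothing, which is
    why strict margins are needed: they pay for the noise. Freezing the comparison vector also
    breaks a circularity, since the noise of the actual iterates can only be controlled once these
    are known to be bounded. Probability theory is thereby confined to martingale transforms with
    weights bounded by 1; the rest of the convergence proof is deterministic on a single sample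
    path. *)

Lemma separating_point (R : realFieldType) (I : finType) (lo hi : pred I)
    (a b : I -> R) :
  (forall i k, lo i -> hi k -> a i <= b k) ->
  exists x, (forall i, lo i -> a i <= x) /\ (forall k, hi k -> x <= b k).
Proof.
move=> ab; have [i0 lo0|nolo] := pickP lo.
  case: (@Order.TotalTheory.arg_maxP _ _ I i0 lo a lo0) => i loi imax.
  by exists (a i); split=> [k /imax//|k hk]; exact: ab.
have [k0 hi0|nohi] := pickP hi.
  case: (@Order.TotalTheory.arg_minP _ _ I k0 hi b hi0) => k hik kmin.
  by exists (b k); split=> [i|i /kmin//]; rewrite nolo.
by exists 0; split=> [i|k]; rewrite ?nolo ?nohi.
Qed.

(* Fourier-Motzkin elimination of the first variable: a row with a positive
   and a row with a negative leading coefficient are combined so that the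
   leading coefficient cancels; all other combinations are set to zero. *)
Lemma farkas_ord (R : realFieldType) (m : nat) (I : finType)
    (A : I -> 'I_m -> R) (b : I -> R) :
  (exists x : 'I_m -> R, forall i, b i <= \sum_j A i j * x j) \/
  (exists2 lam : I -> R, forall i, 0 <= lam i &
     (forall j, \sum_i lam i * A i j = 0) /\ 0 < \sum_i lam i * b i).
Proof.
elim: m I A b => [|m IH] I A b.
  have [i bi|nb] := pickP (fun i => 0 < b i).
    right; exists (fun k => (k == i)%:R) => [k|]; first exact: ler0n.
    split=> [[]//|]; rewrite (bigD1 i)//= eqxx mul1r big1 ?addr0//.
    by move=> k /negPf ->; rewrite mul0r.
  left; exists (fun=> 0) => i; rewrite big_ord0 leNgt.
  by rewrite nb.
pose a i := A i ord0.
pose c (s : I + I * I) (i : I) : R := match s with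
  | inl k => if (a k == 0) && (k == i) then 1 else 0
  | inr (k, l) => if (0 < a k) && (a l < 0) then
       (k == i)%:R * - a l + (l == i)%:R * a k else 0 end.
have c0 s i : 0 <= c s i.
  case: s => [k|[k l]] /=; case: ifP => // /andP[ak al].
  by apply: addr_ge0; apply: mulr_ge0; rewrite ?ler0n// ?oppr_ge0; exact: ltW.
have sumc k l (f : I -> R) : 0 < a k -> a l < 0 ->
    \sum_i c (inr (k, l)) i * f i = - a l * f k + a k * f l.
  move=> ak al /=; rewrite ak al /=.
  under eq_bigr do rewrite mulrDl.
  rewrite big_split /= (bigD1 k)//= [X in _ + X + _]big1 ?eqxx; last first.
    by move=> i /negPf; rewrite eq_sym => ->; rewrite !mul0r.
  rewrite [X in _ + X](bigD1 l)//= [X in _ + (_ + X)]big1 ?eqxx; last first.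
    by move=> i /negPf; rewrite eq_sym => ->; rewrite !mul0r.
  by rewrite !mul1r !addr0.
have sumc0 k (f : I -> R) : a k = 0 -> \sum_i c (inl k) i * f i = f k.
  move=> ak /=; rewrite (bigD1 k)//= ak !eqxx mul1r big1 ?addr0//.
  by move=> i /negPf; rewrite eq_sym => ->; rewrite mul0r.
have ca s : \sum_i c s i * a i = 0.
  case: s => [k|[k l]].
    have [ak|ak] := eqVneq (a k) 0; first by rewrite sumc0.
    by rewrite big1// => i _ /=; rewrite (negPf ak) mul0r.
  have [/andP[ak al]|/negPf kl] := boolP ((0 < a k) && (a l < 0)).
    by rewrite sumc//; ring.
  by rewrite big1// => i _ /=; rewrite kl mul0r.
have [[x hx]|[lam lam0 [lamA lamb]]] :=
  IH _ (fun s j => \sum_i c s i * A i (lift ord0 j)) (fun s => \sum_i c s i * b i).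
  left.
  pose r i := \sum_j A i (lift ord0 j) * x j.
  have hr s : \sum_i c s i * b i <= \sum_i c s i * r i.
    apply: le_trans (hx s) _; rewrite le_eqVlt; apply/orP; left; apply/eqP.
    under eq_bigr do rewrite mulr_suml.
    rewrite exchange_big /=; apply: eq_bigr => i _; rewrite mulr_sumr.
    by apply: eq_bigr => j _; rewrite mulrA.
  (* Back-substitution: rows with a positive coefficient bound the eliminated unknown from below,
     rows with a negative one from above, and the combined rows say that these bounds are
     compatible. *)
  have lohi i k : 0 < a i -> a k < 0 -> (b i - r i) / a i <= (b k - r k) / a k.
    move=> ai ak; rewrite ler_pdivrMr // mulrC mulrA ler_ndivlMr //.
    by have := hr (inr (i, k)); rewrite !sumc//; lra.
  have [x0 [lo hi]] := separating_point lohi.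
  exists (fun j => if unlift ord0 j is Some j' then x j' else x0) => i.
  rewrite big_ord_recl unlift_none.
  under eq_bigr do rewrite liftK.
  rewrite -/(r i) -/(a i).
  have [ai|ai|ai] := ltgtP (a i) 0.
  - by have := hi i ai; rewrite ler_ndivlMr//; lra.
  - by have := lo i ai; rewrite ler_pdivrMr//; lra.
  - by have := hr (inl i); rewrite !sumc0// ai; lra.
right; exists (fun i => \sum_s lam s * c s i).
  by move=> i; apply: sumr_ge0 => s _; exact: mulr_ge0.
have swap (f : I -> R) : \sum_i (\sum_s lam s * c s i) * f i =
    \sum_s lam s * \sum_i c s i * f i.
  under eq_bigr do rewrite mulr_suml.
  rewrite exchange_big /=; apply: eq_bigr => s _; rewrite mulr_sumr.
  by apply: eq_bigr => i _; rewrite mulrA.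
split=> [j|]; last by rewrite swap.
rewrite swap; have [j' ->|->] := unliftP ord0 j; first exact: lamA.
by apply: big1 => s _; rewrite [X in _ * X]ca mulr0.
Qed.

Lemma farkas (R : realFieldType) (I J : finType) (A : I -> J -> R) (b : I -> R) :
  (exists x : J -> R, forall i, b i <= \sum_j A i j * x j) \/
  (exists2 lam : I -> R, forall i, 0 <= lam i &
     (forall j, \sum_i lam i * A i j = 0) /\ 0 < \sum_i lam i * b i).
Proof.
have [[x hx]|[lam lam0 [lamA lamb]]] := @farkas_ord R #|J| I (fun i k => A i (enum_val k)) b.
  left; exists (fun j => x (enum_rank j)) => i; apply: le_trans (hx i) _.
  rewrite (reindex (@enum_rank J))/=; last first.
    by apply: onW_bij; exact: enum_rank_bij.
  by under eq_bigr do rewrite enum_rankK.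
right; exists lam => //; split=> // j.
by have := lamA (enum_rank j); under eq_bigr do rewrite enum_rankK.
Qed.

(* Existence of a saddle point of a matrix game, as feasibility of the linear
   system [rho >= 0, sig >= 0, sum rho = 1, sum sig = 1, rho q <= c <= q sig]
   in the unknowns [(rho, sig, c)]. *)
Lemma matrix_game_saddle (R : realFieldType) (X Y : finType) (q : X -> Y -> R) :
  X -> Y ->
  exists rho sig c, [/\ (forall x, 0 <= rho x) /\ \sum_x rho x = 1,
    (forall y, 0 <= sig y) /\ \sum_y sig y = 1,
    (forall y, \sum_x rho x * q x y <= c) & (forall x, c <= \sum_y sig y * q x y)].
Proof.
move=> x0 y0.
pose Idx : finType := ((X + Y) + (Y + X) + (bool + bool))%type.
pose Var : finType := ((X + Y) + unit)%type.
(* Each normalization is an equality, entered as two inequalities of opposite sign. *)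
pose sg (e : bool) : R := if e then 1 else -1.
pose A (i : Idx) (v : Var) : R := match i, v with
 | inl (inl (inl x)), inl (inl x') => (x == x')%:R
 | inl (inl (inr y)), inl (inr y') => (y == y')%:R
 | inl (inr (inl y)), inl (inl x') => - q x' y
 | inl (inr (inl y)), inr _ => 1
 | inl (inr (inr x)), inl (inr y') => q x y'
 | inl (inr (inr x)), inr _ => - 1
 | inr (inl e), inl (inl _) => sg e
 | inr (inr e), inl (inr _) => sg e
 | _, _ => 0 end.
pose b (i : Idx) : R := match i with
 | inr (inl e) => sg e | inr (inr e) => sg e | _ => 0 end.
have sumIdx (f : Idx -> R) : \sum_i f i =
  \sum_x f (inl (inl (inl x))) + \sum_y f (inl (inl (inr y))) +
  (\sum_y f (inl (inr (inl y))) + \sum_x f (inl (inr (inr x)))) +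
  ((f (inr (inl true)) + f (inr (inl false))) +
   (f (inr (inr true)) + f (inr (inr false)))).
  by rewrite !big_sumType/= !big_bool.
have sumVar (f : Var -> R) : \sum_v f v =
  \sum_x f (inl (inl x)) + \sum_y f (inl (inr y)) + f (inr tt).
  by rewrite !big_sumType/= (bigD1 tt)//= [X in _ + (_ + X)]big1 ?addr0//; case.
have sumD (Z : finType) (f : Z -> R) z : \sum_z' (z == z')%:R * f z' = f z.
  rewrite (bigD1 z)//= eqxx mul1r big1 ?addr0// => z'.
  by rewrite eq_sym => /negPf ->; rewrite mul0r.
have sumD' (Z : finType) (f : Z -> R) z : \sum_z' f z' * (z' == z)%:R = f z.
  by rewrite -[RHS]sumD; apply: eq_bigr => z' _; rewrite mulrC eq_sym.
have [[s hs]|[lam lam0 [lamA lamb]]] := farkas A b.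
  pose rho x := s (inl (inl x)); pose sig y := s (inl (inr y)).
  have z1 (Z : finType) (f : Z -> R) : \sum_z 0 * f z = 0.
    by apply: big1 => z _; rewrite mul0r.
  exists rho, sig, (s (inr tt)); split.
  - split=> [x|].
      have := hs (inl (inl (inl x))); rewrite sumVar /= sumD.
      by rewrite z1 mul0r !addr0.
    have := hs (inr (inl true)); rewrite sumVar /= z1 -mulr_sumr.
    have := hs (inr (inl false)); rewrite sumVar /= z1 -mulr_sumr.
    rewrite -/(\sum_x rho x) /rho; lra.
  - split=> [y|].
      have := hs (inl (inl (inr y))); rewrite sumVar /= sumD.
      by rewrite z1 mul0r !addr0 add0r.
    have := hs (inr (inr true)); rewrite sumVar /= z1 -mulr_sumr.
    have := hs (inr (inr false)); rewrite sumVar /= z1 -mulr_sumr.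
    rewrite /sig; lra.
  - move=> y; have := hs (inl (inr (inl y))); rewrite sumVar /= z1.
    under eq_bigr do rewrite mulNr.
    rewrite sumrN.
    under [X in - X]eq_bigr do rewrite mulrC.
    rewrite /rho; lra.
  - move=> x; have := hs (inl (inr (inr x))); rewrite sumVar /= z1.
    under eq_bigr do rewrite mulrC.
    rewrite /sig; lra.
exfalso.
(* The multipliers [be] and [al] are unnormalized strategies of equal mass m. Averaging [hr] over
   [be] and [hsy] over [al] gives (r + s) m <= 0, so m = 0; then [hr] and [hsy] yield r <= 0 and s
   <= 0, against r + s > 0. *)
pose be x := lam (inl (inr (inr x))); pose al y := lam (inl (inr (inl y))).
pose r := lam (inr (inl true)) - lam (inr (inl false)).
pose s := lam (inr (inr true)) - lam (inr (inr false)).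
have z1 (Z : finType) (f : Z -> R) : \sum_z f z * 0 = 0.
  by apply: big1 => z _; rewrite mulr0.
have rs : 0 < r + s.
  by move: lamb; rewrite sumIdx /b /= !z1 /r /s; lra.
have hr x : r <= \sum_y al y * q x y.
  have := lamA (inl (inl x)); rewrite sumIdx /= !z1 sumD' !mulr0.
  under [X in _ + (X + 0) + _]eq_bigr do rewrite mulrN.
  rewrite sumrN => h; have := lam0 (inl (inl (inl x))).
  rewrite /r /al; lra.
have hsy y : s <= - \sum_x be x * q x y.
  have := lamA (inl (inr y)); rewrite sumIdx /= !z1 sumD' !mulr0.
  move=> h; have := lam0 (inl (inl (inr y))).
  rewrite /s /be; lra.
have m_eq : \sum_y al y = \sum_x be x.
  have := lamA (inr tt); rewrite sumIdx /= !z1 !mulr0.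
  under eq_bigr do rewrite mulr1.
  under [X in _ + (_ + X) + _]eq_bigr do rewrite mulrN1.
  by rewrite sumrN /al /be; lra.
have al0 y : 0 <= al y by exact: lam0.
have be0 x : 0 <= be x by exact: lam0.
have rm : r * \sum_x be x <= \sum_x \sum_y be x * al y * q x y.
  rewrite mulr_sumr; apply: ler_sum => x _.
  under eq_bigr do rewrite -mulrA.
  by rewrite -mulr_sumr mulrC ler_wpM2l.
have sm : s * \sum_y al y <= - \sum_x \sum_y be x * al y * q x y.
  rewrite exchange_big /= -sumrN mulr_sumr; apply: ler_sum => y _.
  under eq_bigr do rewrite -mulrA mulrCA.
  by rewrite -mulr_sumr mulrC -mulrN ler_wpM2l.
have be_sum0 : 0 <= \sum_x be x by exact: sumr_ge0.
have m0 : \sum_x be x = 0.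
  apply/eqP; rewrite eq_le be_sum0 andbT leNgt; apply/negP => mpos.
  by move: sm; rewrite m_eq => sm; have := mulr_gt0 rs mpos; lra.
have beE x : be x = 0 by apply: (psumr_eq0P _ m0).
have alE y : al y = 0 by apply: (psumr_eq0P _ (etrans m_eq m0)).
have := hr x0; have := hsy y0.
rewrite !big1; first lra.
  by move=> y _; rewrite alE mul0r.
by move=> x _; rewrite beE mul0r.
Qed.

(** * One-player cycle problem *)

Lemma finite_ub (R : realDomainType) (I : finType) (f : I -> R) :
  exists2 M : R, 1 <= M & forall i, `|f i| <= M.
Proof.
exists (1 + \sum_i `|f i|); first by rewrite lerDl sumr_ge0.
move=> i; rewrite (bigD1 i)//= addrCA lerDl addr_ge0// sumr_ge0//.
Qed.

Lemma sum_tagged (V : nmodType) (I : finType) (A : I -> finType)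
    (f : {i : I & A i} -> V) : \sum_k f k = \sum_i \sum_(a : A i) f (Tagged A a).
Proof. by rewrite sig_big_dep; apply: eq_bigr => -[]. Qed.

(* A one-player cost-minimization problem on the states ['I_n], with
   substochastic transitions; [lam i a] plays the role of a stationary
   state-action occupation measure. *)
Definition occupation (R : realType) (n : nat) (A : 'I_n -> finType)
    (p : forall i, A i -> 'I_n -> R) (g : forall i, A i -> R)
    (lam : forall i, A i -> R) : Prop :=
  [/\ forall i a, 0 <= lam i a,
      forall j, \sum_i \sum_a lam i a * p i a j = \sum_a lam j a,
      \sum_i \sum_a lam i a * g i a <= 0 &
      exists i, 0 < \sum_a lam i a].

(** Homogenization: an extra unknown [None], forced to be at least 1, multiplies the costs, and
    dividing by it turns the margin 1 into e. In a Farkas certificate the columns [Some j] are the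
    balance equations, and the column [None] makes the cost equal to minus a nonnegative
    multiplier. *)
Lemma strict_subsolution_or_occupation (R : realType) (n : nat) (A : 'I_n -> finType)
    (p : forall i, A i -> 'I_n -> R) (g : forall i, A i -> R) :
  (exists (x : 'I_n -> R) (e : R), 0 < e /\
     forall i a, x i + e <= g i a + \sum_j p i a j * x j) \/
  exists lam, occupation p g lam.
Proof.
pose K : finType := {i : 'I_n & A i}.
pose M (c : option K) (v : option 'I_n) : R := match c, v with
  | Some k, Some j => p (tag k) (tagged k) j - (tag k == j)%:R
  | Some k, None => g (tag k) (tagged k)
  | None, None => 1
  | None, Some _ => 0 end.
have so (I : finType) (f : option I -> R) : \sum_o f o = f None + \sum_i f (Some i).
  rewrite (bigD1 None)//=; congr (_ + _).
  rewrite (reindex_omap Some id)/=; last by case.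
  by apply: eq_bigl => i; rewrite eqxx.
have sD (f : 'I_n -> R) i : \sum_j (i == j)%:R * f j = f i.
  rewrite (bigD1 i)//= eqxx mul1r big1 ?addr0// => j.
  by rewrite eq_sym => /negPf ->; rewrite mul0r.
have sK (f : K -> R) : \sum_k f k = \sum_i \sum_(a : A i) f (Tagged A a).
  exact: sum_tagged.
have [[x hx]|[lam lam0 [lamA lamb]]] := farkas M (fun=> 1).
  left; exists (fun j => x (Some j) / x None), (x None)^-1.
  have y1 : 1 <= x None.
    by have := hx None; rewrite so /= big1 ?addr0 ?mul1r// => j _; rewrite mul0r.
  have y0 : 0 < x None by exact: lt_le_trans y1.
  split=> [|i a]; first by rewrite invr_gt0.
  have := hx (Some (Tagged A a)); rewrite so /=.
  under eq_bigr do rewrite mulrBl.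
  rewrite big_split/= sumrN sD => h.
  under eq_bigr do rewrite mulrA.
  rewrite -mulr_suml -(ler_pM2r y0) !mulrDl !divfK ?mulVf ?gt_eqF//.
  lra.
right; exists (fun i a => lam (Some (Tagged A a))); split.
- by move=> i a; exact: lam0.
- move=> j; have := lamA (Some j); rewrite so /= mulr0 add0r sK/=.
  under eq_bigr do under eq_bigr do rewrite mulrBr.
  under eq_bigr do rewrite big_split/= sumrN -mulr_suml.
  rewrite big_split/= sumrN.
  under [X in _ - X]eq_bigr do rewrite mulrC eq_sym.
  by rewrite sD => /eqP; rewrite subr_eq0 => /eqP.
- have := lamA None; rewrite so /= mulr1 sK/=; have := lam0 None; lra.
- move: lamb; under eq_bigr do rewrite mulr1.
  rewrite so sK /= => h.
  apply: contrapT => /forallNP no.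
  have lamE i (a : A i) : lam (Some (Tagged A a)) = 0.
    have : \sum_(a : A i) lam (Some (Tagged A a)) = 0.
      by apply/eqP; rewrite eq_le sumr_ge0// andbT leNgt; apply/negP/no.
    by move/psumr_eq0P => -> //.
  have := lamA None; rewrite so /= mulr1 sK/= big1; last first.
    by move=> i _; rewrite big1// => a _; rewrite lamE mul0r.
  move: h; rewrite big1; last by move=> i _; rewrite big1.
  lra.
Qed.

(* A minimal-support occupation measure admits a bounded relative cost [h]:
   a Farkas certificate [kap] against [h] would yield, after subtracting
   [kap]-reweighted mass, an occupation measure of smaller support. *)
Lemma occupation_relative_cost (R : realType) (n : nat) (A : 'I_n -> finType)
    (p : forall i, A i -> 'I_n -> R) (g : forall i, A i -> R)
    (lam : forall i, A i -> R) : occupation p g lam ->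
  exists lam' h, occupation p g lam' /\ forall i,
   \sum_a lam' i a * g i a + \sum_a lam' i a * (\sum_j p i a j * h j)
     <= (\sum_a lam' i a) * h i.
Proof.
move: {2}#|_|.+1 (ltnSn #|[set i | 0 < \sum_a lam i a]%SET|) => N.
elim: N lam => // N IH lam; rewrite ltnS => hN [lam0 lamp lamg lampos].
pose L i := \sum_a lam i a.
pose M i j := \sum_a lam i a * p i a j.
have L0 i : 0 <= L i by exact: sumr_ge0.
have [[h hh]|[kap kap0 [kapA kapb]]] :=
  farkas (fun i j => L i * (i == j)%:R - M i j) (fun i => \sum_a lam i a * g i a).
  exists lam, h; split; first by split.
  move=> i; have /= := hh i.
  under [X in _ <= X -> _]eq_bigr do rewrite mulrBl -mulrA.
  rewrite big_split/= sumrN -mulr_sumr.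
  have -> : \sum_j (i == j)%:R * h j = h i.
    rewrite (bigD1 i)//= eqxx mul1r big1 ?addr0// => j.
    by rewrite eq_sym => /negPf ->; rewrite mul0r.
  have -> : \sum_j M i j * h j = \sum_a lam i a * (\sum_j p i a j * h j).
    under eq_bigr do rewrite mulr_suml.
    rewrite exchange_big /=; apply: eq_bigr => a _; rewrite mulr_sumr.
    by apply: eq_bigr => j _; rewrite mulrA.
  by rewrite -/(L i); lra.
have {}kapA j : \sum_i kap i * M i j = kap j * L j.
  have /= := kapA j; under eq_bigr do rewrite mulrBr.
  rewrite big_split/= sumrN (bigD1 j)//= eqxx mulr1 [X in _ + X - _]big1.
    lra.
  by move=> i /negPf ->; rewrite !mulr0.
(* The vector kap L is invariant like L. Subtracting it from kap i0 times L, with kap maximal at i0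
   on the support, keeps nonnegativity and balance and deletes i0. By [kapb] the cost becomes
   strictly negative, so the new measure is not zero. *)
have [i1 Li1] := lampos.
case: (@Order.TotalTheory.arg_maxP _ _ _ i1 (fun i => 0 < L i) kap Li1) => i0 Li0 imax.
pose lam' i a := (kap i0 - kap i) * lam i a.
have Ma i : \sum_a lam' i a = (kap i0 - kap i) * L i by rewrite -mulr_sumr.
have lam'0 i a : 0 <= lam' i a.
  have [Li|] := ltP 0 (L i); first by rewrite mulr_ge0// subr_ge0; exact: imax.
  move=> Li; have L_0 : L i = 0 by apply/eqP; rewrite eq_le Li L0.
  by rewrite /lam' (psumr_eq0P _ L_0) ?mulr0.
have cost : \sum_i \sum_a lam' i a * g i a < 0.
  under eq_bigr do under eq_bigr do rewrite -mulrA mulrBl.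
  under eq_bigr do rewrite big_split /= sumrN -!mulr_sumr.
  rewrite big_split/= sumrN -mulr_sumr.
  have := ler_wpM2l (kap0 i0) lamg; rewrite mulr0; lra.
apply: (IH lam').
  apply: leq_trans hN; apply: proper_card; apply/properP; split.
    apply/fintype.subsetP => i; rewrite !inE Ma => h; rewrite lt_neqAle L0 andbT.
    by apply/eqP => L_0; move: h; rewrite -[L i]L_0 mulr0 ltxx.
  by exists i0; rewrite !inE // Ma subrr mul0r ltxx.
split=> //.
- move=> j; rewrite Ma mulrBl -kapA -[X in kap i0 * X]lamp mulr_sumr -sumrB.
  apply: eq_bigr => i _; rewrite -mulrBl mulr_sumr.
  by apply: eq_bigr => a _; rewrite mulrA.
- exact: ltW.
- apply: contrapT => /forallNP no; move: cost; rewrite big1 ?ltxx// => i _.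
  have : \sum_a lam' i a = 0.
    by apply/eqP; rewrite eq_le sumr_ge0// andbT leNgt; apply/negP/no.
  by move/psumr_eq0P => h; rewrite big1// => a _; rewrite h ?mul0r.
Qed.

(* [z] bounds the expected termination time of [mub], hence [mub] has bounded
   costs; [mub] is used outside the recurrent set [C] of [mu]. *)
Lemma strict_subsolution_or_cycle (R : realType) (n : nat) (A : 'I_n -> finType)
    (p : forall i, A i -> 'I_n -> R) (g : forall i, A i -> R)
    (mub : forall i, A i -> R) (z : 'I_n -> R) :
  (forall i a j, 0 <= p i a j) -> (forall i a, \sum_j p i a j <= 1) ->
  (forall i, is_dist (mub i)) -> (forall i, 1 <= z i) ->
  (forall i, 1 + \sum_a mub i a * (\sum_j p i a j * z j) <= z i) ->
  (exists (x : 'I_n -> R) (e : R), 0 < e /\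
     forall i a, x i + e <= g i a + \sum_j p i a j * x j) \/
  exists (mu : forall i, A i -> R) (C : {pred 'I_n}) (h : 'I_n -> R),
    [/\ forall i, is_dist (mu i), exists i, i \in C,
        forall i, i \in C -> \sum_(j in C) \sum_a mu i a * p i a j = 1 &
        forall i, \sum_a mu i a * (g i a + \sum_j p i a j * h j) <= h i].
Proof.
move=> p0 p1 mubd z1 hz.
have [|[lam /occupation_relative_cost[{}lam [h [[lam0 lamp _ lampos] hh]]]]] :=
  strict_subsolution_or_occupation p g; first by left.
right.
pose L i := \sum_a lam i a.
have L0 i : 0 <= L i by exact: sumr_ge0.
pose C : {pred 'I_n} := fun i => 0 < L i.
pose mu i a := if 0 < L i then lam i a / L i else mub i a.
have mud i : is_dist (mu i).
  have [Li|nLi] := boolP (0 < L i); last by rewrite /mu (negPf nLi).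
  rewrite /mu Li; split=> [a|]; first by rewrite divr_ge0.
  by rewrite -mulr_suml divff// gt_eqF.
have LM i j : L i * (\sum_a mu i a * p i a j) = \sum_a lam i a * p i a j.
  have [Li|nLi] := boolP (0 < L i).
    rewrite /mu Li mulr_sumr; apply: eq_bigr => a _.
    by rewrite mulrA mulrCA divff ?gt_eqF// mulr1.
  have L_0 : L i = 0 by apply/eqP; rewrite eq_le L0 andbT leNgt.
  by rewrite L_0 mul0r big1// => a _; rewrite (psumr_eq0P (fun a _ => lam0 i a) L_0) ?mul0r.
have P0 i j : 0 <= \sum_a mu i a * p i a j.
  by apply: sumr_ge0 => a _; rewrite mulr_ge0//; case: (mud i).
have P1 i : \sum_j \sum_a mu i a * p i a j <= 1.
  rewrite exchange_big /=; have [m0 <-] := mud i; apply: ler_sum => a _.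
  by rewrite -mulr_sumr ler_piMr.
have LP j : \sum_i L i * (\sum_a mu i a * p i a j) = L j.
  by rewrite -[RHS]lamp; apply: eq_bigr.
(* Invariance of L makes its support closed: nothing flows into a null state, and, the total mass
   being preserved, no row of the support loses mass. *)
have Pout i j : 0 < L i -> ~~ (0 < L j) -> \sum_a mu i a * p i a j = 0.
  move=> Li nLj; have L_0 : L j = 0 by apply/eqP; rewrite eq_le L0 andbT leNgt.
  have := LP j; rewrite L_0 => /psumr_eq0P h0; have := h0 (fun i _ => mulr_ge0 (L0 i) (P0 i j)) i isT.
  by move/eqP; rewrite mulf_eq0 gt_eqF//= => /eqP.
have Prow i : 0 < L i -> \sum_j \sum_a mu i a * p i a j = 1.
  move=> Li; have E : \sum_i L i * (1 - \sum_j \sum_a mu i a * p i a j) = 0.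
    under eq_bigr do rewrite mulrBr mulr1 mulr_sumr.
    by rewrite big_split/= sumrN exchange_big/=; under [X in _ - X]eq_bigr do rewrite LP; rewrite subrr.
  have /(_ i isT)/eqP := psumr_eq0P (fun k _ => mulr_ge0 (L0 k) (etrans (subr_ge0 _ _) (P1 k))) E.
  by rewrite mulf_eq0 gt_eqF//= subr_eq0 => /eqP.
have [K1 K11 hK1] := finite_ub h.
have [K2 K21 hK2] := finite_ub (fun i => \sum_a mub i a * g i a).
(* [K1] ensures hf <= K z everywhere, and [K2] bounds the one-stage cost of [mub], so that the
   inequality for z, scaled by K, settles the states outside [C]. *)
pose K := K1 + K2.
pose hf i := if 0 < L i then h i else K * z i.
exists mu, C, hf; split=> // [i Ci|i].
  rewrite -[RHS](Prow i Ci) [RHS](bigID C)/= [X in _ + X]big1 ?addr0// => j.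
  exact: Pout.
under eq_bigr do rewrite mulrDr.
rewrite big_split/=.
have swap (m : A i -> R) (f : 'I_n -> R) :
    \sum_a m a * (\sum_j p i a j * f j) = \sum_j (\sum_a m a * p i a j) * f j.
  under eq_bigr do rewrite mulr_sumr.
  rewrite exchange_big /=; apply: eq_bigr => j _; rewrite mulr_suml.
  by apply: eq_bigr => a _; rewrite mulrA.
rewrite swap {2}/hf; case: ifPn => [Li|nLi].
  have -> : \sum_j (\sum_a mu i a * p i a j) * hf j = \sum_j (\sum_a mu i a * p i a j) * h j.
    apply: eq_bigr => j _; rewrite /hf; case: ifPn => // nLj.
    by rewrite (Pout i j)// !mul0r.
  rewrite -swap -(ler_pM2l Li); apply: le_trans (hh i).
  rewrite mulrDr !mulr_sumr; apply: lerD; apply: ler_sum => a _;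
  by rewrite mulrA /mu Li mulrCA divff ?gt_eqF// mulr1.
have hfK j : hf j <= K * z j.
  rewrite /hf; case: ifP => // _; apply: (@le_trans _ _ K); last by rewrite ler_peMr// /K; lra.
  by have := hK1 j; rewrite ler_norml /K => /andP[_]; lra.
apply: (@le_trans _ _ (K + \sum_j (\sum_a mu i a * p i a j) * (K * z j))).
  apply: lerD.
    by have := hK2 i; rewrite ler_norml /mu (negPf nLi) /K => /andP[_]; lra.
  by apply: ler_sum => j _; rewrite ler_wpM2l.
under eq_bigr do rewrite mulrCA.
rewrite -mulr_sumr -swap /mu (negPf nLi) -[X in X + _]mulr1 -mulrDr.
by rewrite ler_wpM2l// /K; lra.
Qed.

(** * Values and induced Markov chains *)

Lemma is_dist_avg_ge (R : realType) (X : finType) (r f : X -> R) (c : R) :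
  is_dist r -> (forall x, c <= f x) -> c <= \sum_x r x * f x.
Proof.
move=> [r0 r1] cf; rewrite -[c]mul1r -r1 mulr_suml; apply: ler_sum => x _.
exact: ler_wpM2l.
Qed.

Lemma is_dist_avg_le (R : realType) (X : finType) (r f : X -> R) (c : R) :
  is_dist r -> (forall x, f x <= c) -> \sum_x r x * f x <= c.
Proof.
move=> [r0 r1] cf; rewrite -[c]mul1r -r1 mulr_suml; apply: ler_sum => x _.
exact: ler_wpM2l.
Qed.

(** Testing against [sig] bounds every inner supremum below by the saddle value, and [rho] attains
    it. The bounds are proved explicitly because [sup] and [inf] of unbounded sets are mere default
    values. *)
Lemma infsup_saddle (R : realType) (X Y : finType) (q : X -> Y -> R) : X -> Y ->
  exists rho sig, [/\ is_dist rho, is_dist sig,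
    forall y, \sum_x rho x * q x y <= infsup q &
    forall x, infsup q <= \sum_y sig y * q x y].
Proof.
move=> x0 y0.
have [rho [sig [c [drho dsig rhoc csig]]]] := matrix_game_saddle q x0 y0.
have bilE (r : X -> R) (s : Y -> R) : bil q r s = \sum_y s y * \sum_x r x * q x y.
  rewrite /bil exchange_big /=; apply: eq_bigr => y _.
  by rewrite mulr_sumr; apply: eq_bigr => x _; ring.
have bilE' (r : X -> R) (s : Y -> R) : bil q r s = \sum_x r x * \sum_y s y * q x y.
  rewrite /bil /=; apply: eq_bigr => x _.
  by rewrite mulr_sumr; apply: eq_bigr => y _; ring.
have ub r : is_dist r -> has_ubound [set bil q r s | s in [set s | @is_dist R Y s]].
  move=> dr; have [M _ hM] := finite_ub (fun y => \sum_x r x * q x y).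
  exists M => _ [s ds <-]; rewrite bilE; apply: is_dist_avg_le => // y.
  exact: le_trans (ler_norm _) (hM y).
have low r : is_dist r -> c <= sup [set bil q r s | s in [set s | @is_dist R Y s]].
  move=> dr; apply: (@le_trans _ _ (bil q r sig)).
    by rewrite bilE'; exact: is_dist_avg_ge.
  by apply: ub_le_sup; [exact: ub|exists sig].
suff -> : infsup q = c by exists rho, sig.
apply/eqP; rewrite eq_le; apply/andP; split.
  apply: (@le_trans _ _ (sup [set bil q rho s | s in [set s | @is_dist R Y s]])).
    apply: ge_inf; last by exists rho.
    by exists c => _ [r dr <-]; exact: low.
  apply: ge_sup; first by exists (bil q rho sig), sig.
  by move=> _ [s ds <-]; rewrite bilE; exact: is_dist_avg_le.
apply: lb_le_inf; last by move=> _ [r dr <-]; exact: low.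
by exists (sup [set bil q rho s | s in [set s | @is_dist R Y s]]), rho.
Qed.

(** Play the minimizer's saddle strategy for [q'] against the maximizer's for [q]: the payoff under
    [q] is at least [infsup q], the payoff under [q'] at most [infsup q']. *)
Lemma infsup_le_shift (R : realType) (X Y : finType) (q q' : X -> Y -> R) (c : R) :
  X -> Y -> (forall x y, q x y <= q' x y + c) -> infsup q <= infsup q' + c.
Proof.
move=> x0 y0 qq'.
have [rho [_ [drho _ hr _]]] := infsup_saddle q' x0 y0.
have [_ [sig [_ dsig _ hs]]] := infsup_saddle q x0 y0.
apply: le_trans (is_dist_avg_ge drho hs) _.
under eq_bigr do rewrite mulr_sumr.
rewrite exchange_big /=.
apply: (@le_trans _ _ (\sum_y sig y * (\sum_x rho x * q' x y + c))).
  apply: ler_sum => y _.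
  under eq_bigr do rewrite mulrCA.
  rewrite -mulr_sumr; apply: ler_wpM2l; first by case: dsig.
  have [r0 r1] := drho; rewrite -[c in _ <= _ + c]mul1r -r1 mulr_suml -big_split/=.
  by apply: ler_sum => x _; rewrite -mulrDr ler_wpM2l.
by apply: is_dist_avg_le => // y; rewrite lerD2r.
Qed.

Lemma infsup_ge_response (R : realType) (X Y : finType) (q : X -> Y -> R)
    (sig : Y -> R) (c : R) : X -> Y -> is_dist sig ->
  (forall x, c <= \sum_y sig y * q x y) -> c <= infsup q.
Proof.
move=> x0 y0 dsig hc; have [rho [_ [drho _ hr _]]] := infsup_saddle q x0 y0.
apply: le_trans (is_dist_avg_ge drho hc) _.
under eq_bigr do rewrite mulr_sumr.
rewrite exchange_big /=.
apply: le_trans (is_dist_avg_le dsig hr); apply: ler_sum => y _.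
by under eq_bigr do rewrite mulrCA; rewrite -mulr_sumr.
Qed.

Lemma infsup_le_response (R : realType) (X Y : finType) (q : X -> Y -> R)
    (rho : X -> R) (c : R) : X -> Y -> is_dist rho ->
  (forall y, \sum_x rho x * q x y <= c) -> infsup q <= c.
Proof.
move=> x0 y0 drho hc; have [_ [sig [_ dsig _ hs]]] := infsup_saddle q x0 y0.
apply: le_trans (is_dist_avg_ge drho hs) _.
under eq_bigr do rewrite mulr_sumr.
rewrite exchange_big /=.
apply: le_trans (is_dist_avg_le dsig hc); apply: ler_sum => y _.
by under eq_bigr do rewrite mulrCA; rewrite -mulr_sumr.
Qed.

Lemma limn_einf_bounded_above (R : realType) (u : nat -> R) (B : R) :
  (forall t, u t <= B) -> (limn_einf (fun t => (u t)%:E) < +oo)%E.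
Proof.
move=> uB; apply: (@le_lt_trans _ _ B%:E); last exact: ltry.
rewrite limn_einf_lim; apply: lime_le; first exact: is_cvg_einfs.
apply: nearW => t; apply: (@le_trans _ _ (u t)%:E); last by rewrite lee_fin.
by apply: ereal_inf_lbound; exists t => //=.
Qed.

Lemma limn_einf_bounded_below (R : realType) (u : nat -> R) (B : R) :
  (forall t, B <= u t) -> (-oo < limn_einf (fun t => (u t)%:E))%E.
Proof.
move=> uB; apply: (@lt_le_trans _ _ B%:E); first exact: ltNyr.
rewrite limn_einf_lim; apply: lime_ge; first exact: is_cvg_einfs.
apply: nearW => t; apply: le_ereal_inf_tmp => _ [s _ <-].
by rewrite lee_fin.
Qed.

(** * Survival probabilities and finite-horizon costs of a stationary pair *)

Section markov_chain.
Variables (R : realType) (n : nat) (U V : 'I_n -> finType).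
Variables (p ghat : SA U V -> option 'I_n -> R).
Hypothesis p0 : forall l j, 0 <= p l j.
Hypothesis p1 : forall l, \sum_(j : option 'I_n) p l j = 1.
Unset Implicit Arguments.
Variables (mu : forall i : 'I_n, U i -> R) (nu : forall i : 'I_n, V i -> R).
Set Implicit Arguments.
Hypotheses (dmu : forall i, is_dist (mu i)) (dnu : forall i, is_dist (nu i)).
Local Notation P := (Pmn p mu nu).
Local Notation K := (kstep p mu nu).
Local Notation g := (gmn p ghat mu nu).
Implicit Types (f h : 'I_n -> R).

Lemma sum_option (I : finType) (F : option I -> R) :
  \sum_o F o = F None + \sum_i F (Some i).
Proof.
rewrite (bigD1 None)//=; congr (_ + _).
rewrite (reindex_omap Some id)/=; last by case.
by apply: eq_bigl => i; rewrite eqxx.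
Qed.

Lemma row_le1 l : \sum_j p l (Some j) <= 1.
Proof. by rewrite -(p1 l) sum_option lerDr. Qed.

Lemma Pmn_ge0 i j : 0 <= P i j.
Proof.
have [m0 _] := dmu i; have [n0 _] := dnu i.
by apply: sumr_ge0 => u _; apply: sumr_ge0 => v _; rewrite !mulr_ge0.
Qed.

Lemma Pmn_apply i f : \sum_j P i j * f j =
  \sum_u \sum_v mu i u * nu i v * \sum_j p (triple u v) (Some j) * f j.
Proof.
under eq_bigr do rewrite mulr_suml.
rewrite exchange_big /=; apply: eq_bigr => u _.
under eq_bigr do rewrite mulr_suml.
rewrite exchange_big /=; apply: eq_bigr => v _.
by rewrite mulr_sumr; apply: eq_bigr => j _; rewrite mulrA.
Qed.

Lemma Pmn_row_le1 i : \sum_j P i j <= 1.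
Proof.
have := Pmn_apply i (fun=> 1); under eq_bigr do rewrite mulr1.
move=> ->; have [m0 m1] := dmu i.
under eq_bigr do under eq_bigr do rewrite -mulrA.
under eq_bigr do rewrite -mulr_sumr.
apply: is_dist_avg_le => // u; apply: is_dist_avg_le => // v.
by under eq_bigr do rewrite mulr1; exact: row_le1.
Qed.

Lemma kstep0 i f : \sum_j K 0 i j * f j = f i.
Proof.
rewrite (bigD1 i)//= eqxx mul1r big1 ?addr0// => j.
by rewrite eq_sym => /negPf ->; rewrite mul0r.
Qed.

Lemma kstepS k i f :
  \sum_j K k.+1 i j * f j = \sum_j K k i j * \sum_l P j l * f l.
Proof.
under eq_bigr do rewrite mulr_suml.
rewrite exchange_big /=; apply: eq_bigr => j _.
by rewrite mulr_sumr; apply: eq_bigr => l _; rewrite mulrA.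
Qed.

Lemma kstep_ge0 k i j : 0 <= K k i j.
Proof.
elim: k j => [|k IH] j /=; first by case: ifP.
by apply: sumr_ge0 => l _; rewrite mulr_ge0// Pmn_ge0.
Qed.

Lemma kstep_mono k i f h : (forall j, f j <= h j) ->
  \sum_j K k i j * f j <= \sum_j K k i j * h j.
Proof. by move=> fh; apply: ler_sum => j _; rewrite ler_wpM2l// kstep_ge0. Qed.

Lemma kstep_mass k i : \sum_j K k i j = \sum_j K k i j * 1.
Proof. by apply: eq_bigr => j _; rewrite mulr1. Qed.

Lemma kstep_massS k i : \sum_j K k.+1 i j <= \sum_j K k i j.
Proof.
rewrite [leLHS]kstep_mass kstepS [leRHS]kstep_mass; apply: kstep_mono => j.
by under eq_bigr do rewrite mulr1; exact: Pmn_row_le1.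
Qed.

Lemma kstep_mass_anti i k k' : (k <= k')%N -> \sum_j K k' i j <= \sum_j K k i j.
Proof.
move=> /subnK <-; elim: (k' - k)%N => // m IH; rewrite addSn.
exact: le_trans (kstep_massS _ _) IH.
Qed.

Lemma kstep_mass_le1 k i : \sum_j K k i j <= 1.
Proof.
apply: le_trans (kstep_mass_anti i (leq0n k)) _.
by rewrite kstep_mass kstep0.
Qed.

Lemma kstep_bound k i f M : 0 <= M -> (forall j, `|f j| <= M) ->
  `|\sum_j K k i j * f j| <= M.
Proof.
move=> M0 fM; apply: le_trans (ler_norm_sum _ _ _) _.
apply: (@le_trans _ _ (\sum_j K k i j * M)).
  by apply: ler_sum => j _; rewrite normrM ger0_norm ?kstep_ge0// ler_wpM2l// kstep_ge0.
by rewrite -mulr_suml ler_piMl// kstep_mass_le1.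
Qed.

(** The costs are dominated by h - P h, whose expectations telescope along the chain. As h is
    bounded, a one-sided Bellman inequality thus bounds all partial costs on that side. *)
Lemma potential_cost_le h : (forall i, g i + \sum_j P i j * h j <= h i) ->
  forall t i, \sum_(k < t) \sum_j K k i j * g j <= h i - \sum_j K t i j * h j.
Proof.
move=> hh t i; elim: t => [|t IH]; first by rewrite big_ord0 kstep0 subrr.
have hj j : g j <= h j - \sum_l P j l * h l by have := hh j; lra.
rewrite big_ord_recr /=; apply: le_trans (lerD IH (kstep_mono t i hj)) _.
under [X in _ + X]eq_bigr do rewrite mulrBr.
by rewrite sumrB -kstepS; lra.
Qed.

Lemma potential_cost_ge h : (forall i, h i <= g i + \sum_j P i j * h j) ->
  forall t i, h i - \sum_j K t i j * h j <= \sum_(k < t) \sum_j K k i j * g j.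
Proof.
move=> hh t i; elim: t => [|t IH]; first by rewrite big_ord0 kstep0 subrr.
have hj j : h j - \sum_l P j l * h l <= g j by have := hh j; lra.
rewrite big_ord_recr /=; apply: le_trans (lerD IH (kstep_mono t i hj)).
under [X in _ <= _ + X]eq_bigr do rewrite mulrBr.
by rewrite sumrB -kstepS; lra.
Qed.

Lemma Jsr_lt_pinfty h : (forall i, g i + \sum_j P i j * h j <= h i) ->
  forall i, (Jsr p ghat mu nu i < +oo)%E.
Proof.
move=> hh i; have [M M1 hM] := finite_ub h.
apply: (@limn_einf_bounded_above _ _ (h i + M)) => t.
apply: le_trans (potential_cost_le hh t.+1 i) _; rewrite lerD2l.
have := @kstep_bound t.+1 i h M (le_trans ler01 M1) hM.
by rewrite ler_norml => /andP[]; lra.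
Qed.

Lemma Jsr_gt_ninfty h : (forall i, h i <= g i + \sum_j P i j * h j) ->
  forall i, (-oo < Jsr p ghat mu nu i)%E.
Proof.
move=> hh i; have [M M1 hM] := finite_ub h.
apply: (@limn_einf_bounded_below _ _ (h i - M)) => t.
apply: le_trans (potential_cost_ge hh t.+1 i); rewrite lerD2l.
have := @kstep_bound t.+1 i h M (le_trans ler01 M1) hM.
by rewrite ler_norml => /andP[]; lra.
Qed.

Lemma prolonging_closed (C : {pred 'I_n}) : (exists i, i \in C) ->
  (forall i, i \in C -> \sum_(j in C) P i j = 1) -> prolonging p mu nu.
Proof.
move=> [i iC] hC; exists i, 1 => // k.
apply: (@le_trans _ _ (\sum_j K k i j * (j \in C)%:R)); last first.
  by rewrite [leRHS]kstep_mass; apply: kstep_mono => j; case: (j \in C).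
elim: k => [|k IH]; first by rewrite kstep0 iC.
apply: le_trans IH _; rewrite kstepS; apply: kstep_mono => j.
have E : \sum_l P j l * (l \in C)%:R = \sum_(l in C) P j l.
  rewrite [RHS]big_mkcond/=; apply: eq_bigr => l _.
  by case: (l \in C); rewrite ?mulr1 ?mulr0.
have [jC|_] := boolP (j \in C); first by rewrite E hC.
by rewrite E sumr_ge0// => l _; exact: Pmn_ge0.
Qed.

(** Survival probabilities are nonincreasing in time, so the largest of the finitely many individual
    horizons serves all initial states. *)
Lemma nonprolonging_half : ~ prolonging p mu nu ->
  exists N, forall i, \sum_j K N i j <= 2^-1.
Proof.
move=> np.
have H i : exists k, \sum_j K k i j <= 2^-1.
  apply: contrapT => /forallNP no; apply: np; exists i, 2^-1 => // k.
  by have /negP := no k; rewrite -ltNge => /ltW.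
have [f hf] := choice H; exists (\max_i f i) => i.
by apply: le_trans (hf i); apply: kstep_mass_anti; exact: leq_bigmax.
Qed.

(** First-step decomposition; [kstep] itself recurses on the last step. *)
Lemma kstepSl k i f :
  \sum_j K k.+1 i j * f j = \sum_l P i l * \sum_j K k l j * f j.
Proof.
elim: k f => [|k IH] f.
  by rewrite kstepS kstep0; apply: eq_bigr => j _; rewrite kstep0.
rewrite kstepS IH; apply: eq_bigr => l _.
by rewrite kstepS.
Qed.

(** Twice a truncated expected termination time replaces the infinite series. If S is the sum of the
    survival probabilities up to time N - 1, then P S = S - 1 + m N, and m N <= 1/2 gives 1 + 2 P S
    <= 2 S. *)
Lemma nonprolonging_time : ~ prolonging p mu nu ->
  exists z, (forall i, 1 <= z i) /\ (forall i, 1 + \sum_j P i j * z j <= z i).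
Proof.
move=> /nonprolonging_half[N hN].
pose m k i := \sum_j K k i j.
have m0 i : m 0 i = 1 by rewrite /m kstep_mass kstep0.
have mS k i : \sum_j P i j * m k j = m k.+1 i.
  rewrite /m [RHS]kstep_mass kstepSl; apply: eq_bigr => j _.
  by rewrite kstep_mass.
exists (fun i => 2 * \sum_(k < N) m k i); split=> i.
  case: N hN => [|N] hN; first by have := hN i; rewrite -/(m 0 i) m0; lra.
  rewrite big_ord_recl m0.
  have : 0 <= \sum_(k < N) m (lift ord0 k) i.
    by apply: sumr_ge0 => k _; apply: sumr_ge0 => j _; exact: kstep_ge0.
  lra.
have -> : \sum_j P i j * (2 * \sum_(k < N) m k j) = 2 * \sum_(k < N) m k.+1 i.
  under eq_bigr do rewrite mulrCA.
  rewrite -mulr_sumr; congr (_ * _).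
  under eq_bigr do rewrite mulr_sumr.
  by rewrite exchange_big /=; apply: eq_bigr => k _; rewrite mS.
have : m 0 i + \sum_(k < N) m k.+1 i = \sum_(k < N) m k i + m N i.
  rewrite -(big_ord_recr N (fun k => m k i)).
  by rewrite big_ord_recl.
by rewrite m0; have := hN i; rewrite -/(m N i); lra.
Qed.

End markov_chain.

(** * The SSP game operator *)

Lemma is_dist_inhabited (R : realType) (X : finType) (f : X -> R) :
  is_dist f -> X.
Proof.
move=> [_ f1]; suff: exists x : X, True by move=> /cid[].
apply: contrapT => /forallNP no; move: f1.
rewrite big1 => [/esym/eqP|x]; first by rewrite oner_eq0.
by have := no x.
Qed.

Section game.
Variables (R : realType) (n : nat) (U V : 'I_n -> finType).
Variables (p ghat : SA U V -> option 'I_n -> R).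
Hypothesis p0 : forall l j, 0 <= p l j.
Hypothesis p1 : forall l, \sum_(j : option 'I_n) p l j = 1.
Hypothesis Hmodel : SSP_assumption p ghat.

Lemma SSP_inhabited : (forall i, U i) * (forall i, V i).
Proof.
have [/cid2[mu dmu _] /cid2[nu dnu _] _] : [/\
  exists2 mu : forall i, U i -> R, is_srpolU mu & True,
  exists2 nu : forall i, V i -> R, is_srpolU nu & True & True].
  by case: Hmodel => -[mu dmu _] [nu dnu _] _; split; [exists mu|exists nu|].
by split=> i; [exact: (is_dist_inhabited (dmu i))|exact: (is_dist_inhabited (dnu i))].
Qed.

Lemma finite_cost_nonprolonging (mu : forall i, U i -> R) (nu : forall i, V i -> R) :
  is_srpolU mu -> is_srpolU nu ->
  (forall i, Jsr p ghat mu nu i < +oo)%E -> (forall i, -oo < Jsr p ghat mu nu i)%E ->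
  ~ prolonging p mu nu.
Proof.
move=> dmu dnu Jlt Jgt pro; have [_ _ H3] := Hmodel.
have [i [Ji|Ji]] := H3 mu nu dmu dnu pro.
  by have := Jlt i; rewrite Ji.
by have := Jgt i; rewrite Ji.
Qed.

Lemma PmnE (mu : forall i, U i -> R) (nu : forall i, V i -> R) i j :
  Pmn p mu nu i j = \sum_u mu i u * \sum_v nu i v * p (triple u v) (Some j).
Proof.
apply: eq_bigr => u _; rewrite mulr_sumr; apply: eq_bigr => v _.
by rewrite mulrA.
Qed.

Lemma PmnE' (mu : forall i, U i -> R) (nu : forall i, V i -> R) i j :
  Pmn p mu nu i j = \sum_v nu i v * \sum_u mu i u * p (triple u v) (Some j).
Proof.
rewrite /Pmn exchange_big /=; apply: eq_bigr => u _; rewrite mulr_sumr.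
by apply: eq_bigr => v _; rewrite mulrCA mulrA.
Qed.

Lemma gmnE (mu : forall i, U i -> R) (nu : forall i, V i -> R) i :
  gmn p ghat mu nu i = \sum_u mu i u * \sum_v nu i v * gexp p ghat (triple u v).
Proof.
apply: eq_bigr => u _; rewrite mulr_sumr; apply: eq_bigr => v _.
by rewrite mulrA.
Qed.

Lemma gmnE' (mu : forall i, U i -> R) (nu : forall i, V i -> R) i :
  gmn p ghat mu nu i = \sum_v nu i v * \sum_u mu i u * gexp p ghat (triple u v).
Proof.
rewrite /gmn exchange_big /=; apply: eq_bigr => u _; rewrite mulr_sumr.
by apply: eq_bigr => v _; rewrite mulrCA mulrA.
Qed.

Lemma sum_mul_swap (I J : finType) (a : I -> R) (b : I -> J -> R) (c : J -> R) :
  \sum_i a i * (\sum_j b i j * c j) = \sum_j (\sum_i a i * b i j) * c j.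
Proof.
under eq_bigr do rewrite mulr_sumr.
rewrite exchange_big /=; apply: eq_bigr => j _; rewrite mulr_suml.
by apply: eq_bigr => i _; rewrite mulrA.
Qed.

(* Fix the policy [nub] of the maximizer: a cycle of the resulting one-player
   problem would be a prolonging pair of finite cost. *)
Lemma Fop_strict_subsolution : exists (Z : SA U V -> R) (e : R), 0 < e /\
  forall l, Z l + e <= Fop p ghat Z l.
Proof.
have [u0 v0] := SSP_inhabited.
have [[mub dmub H1] [nub dnub H2] _] := Hmodel.
have [z [z1 hz]] := nonprolonging_time p0 p1 dmub dnub
  (finite_cost_nonprolonging dmub dnub (H1 nub dnub) (H2 mub dmub)).
pose p' i (u : U i) j := \sum_v nub i v * p (triple u v) (Some j).
pose g' i (u : U i) := \sum_v nub i v * gexp p ghat (triple u v).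
have p'0 i (u : U i) j : 0 <= p' i u j.
  by apply: sumr_ge0 => v _; rewrite mulr_ge0//; case: (dnub i).
have p'1 i (u : U i) : \sum_j p' i u j <= 1.
  rewrite exchange_big /=; under eq_bigr do rewrite -mulr_sumr.
  by apply: is_dist_avg_le => // v; exact: row_le1.
have z' i : 1 + \sum_a mub i a * (\sum_j p' i a j * z j) <= z i.
  rewrite sum_mul_swap; under eq_bigr do rewrite -PmnE; exact: hz.
have [[x [e [e0 hx]]]|[mu [C [h [dmu C0 Ccl hh]]]]] :=
  strict_subsolution_or_cycle g' p'0 p'1 dmub z1 z'; last first.
  exfalso; apply: (finite_cost_nonprolonging dmu dnub _ (H2 mu dmu)).
    apply: (@Jsr_lt_pinfty _ _ _ _ p ghat p0 p1 mu nub dmu dnub h) => i.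
    apply: le_trans (hh i); under [leRHS]eq_bigr do rewrite mulrDr.
    rewrite big_split /= -gmnE sum_mul_swap.
    by under [X in _ <= _ + X]eq_bigr do rewrite -PmnE.
  apply: (prolonging_closed p0 dmu dnub C0) => i iC; rewrite -[RHS](Ccl i iC).
  by apply: eq_bigr => j _; rewrite PmnE.
(* One-step lookahead from x, lowered by half the margin. A gain in [mmval] alone would be lost on
   rows leading straight to termination; the lowering leaves x <= mmval Z and still yields Z + e/2
   <= F Z. *)
pose Z l := gexp p ghat l + \sum_j p l (Some j) * x j - e / 2.
exists Z, (e / 2); split=> [|l]; first by rewrite divr_gt0.
have mmZ j : x j + e / 2 <= mmval Z (Some j).
  apply: (infsup_ge_response (u0 j) (v0 j) (dnub j)) => u.
  have : \sum_v nub j v * Z (triple u v) = g' j u + \sum_k p' j u k * x k - e / 2.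
    have -> : e / 2 = \sum_v nub j v * (e / 2) by rewrite -mulr_suml (dnub j).2 mul1r.
    rewrite -sum_mul_swap -big_split/= -sumrB.
    by apply: eq_bigr => v _; rewrite /Z mulrBr mulrDr.
  by move=> ->; have := hx j u; lra.
rewrite /Z subrK lerD2l; apply: ler_sum => j _; apply: ler_wpM2l => //.
by apply: le_trans (mmZ j); lra.
Qed.

(** Now [mub] is fixed and the maximizer minimizes the negated cost, so x enters Z with a minus
    sign. Negating the game would turn [infsup] into a sup-inf, hence the argument is repeated
    rather than deduced. *)
Lemma Fop_strict_supersolution : exists (Z : SA U V -> R) (e : R), 0 < e /\
  forall l, Fop p ghat Z l + e <= Z l.
Proof.
have [u0 v0] := SSP_inhabited.
have [[mub dmub H1] [nub dnub H2] _] := Hmodel.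
have [z [z1 hz]] := nonprolonging_time p0 p1 dmub dnub
  (finite_cost_nonprolonging dmub dnub (H1 nub dnub) (H2 mub dmub)).
pose p' i (v : V i) j := \sum_u mub i u * p (triple u v) (Some j).
pose g' i (v : V i) := - \sum_u mub i u * gexp p ghat (triple u v).
have p'0 i (v : V i) j : 0 <= p' i v j.
  by apply: sumr_ge0 => u _; rewrite mulr_ge0//; case: (dmub i).
have p'1 i (v : V i) : \sum_j p' i v j <= 1.
  rewrite exchange_big /=; under eq_bigr do rewrite -mulr_sumr.
  by apply: is_dist_avg_le => // u; exact: row_le1.
have z' i : 1 + \sum_a nub i a * (\sum_j p' i a j * z j) <= z i.
  rewrite sum_mul_swap; under eq_bigr do rewrite -PmnE'; exact: hz.
have [[x [e [e0 hx]]]|[nu [C [h [dnu C0 Ccl hh]]]]] :=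
  strict_subsolution_or_cycle g' p'0 p'1 dnub z1 z'; last first.
  exfalso; apply: (finite_cost_nonprolonging dmub dnu (H1 nu dnu)).
    apply: (@Jsr_gt_ninfty _ _ _ _ p ghat p0 p1 mub nu dmub dnu (fun i => - h i)) => i.
    rewrite lerNl; apply: le_trans (hh i); under [leRHS]eq_bigr do rewrite mulrDr mulrN.
    rewrite big_split /= sumrN -gmnE' sum_mul_swap opprD lerD2l.
    under [X in - X]eq_bigr do rewrite mulrN.
    by rewrite sumrN opprK; under [X in _ <= X]eq_bigr do rewrite -PmnE'.
  apply: (prolonging_closed p0 dmub dnu C0) => i iC; rewrite -[RHS](Ccl i iC).
  by apply: eq_bigr => j _; rewrite PmnE'.
pose Z l := gexp p ghat l - \sum_j p l (Some j) * x j + e / 2.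
exists Z, (e / 2); split=> [|l]; first by rewrite divr_gt0.
have mmZ j : mmval Z (Some j) <= - x j - e / 2.
  apply: (infsup_le_response (u0 j) (v0 j) (dmub j)) => v.
  have : \sum_u mub j u * Z (triple u v) = - g' j v - \sum_k p' j v k * x k + e / 2.
    have -> : e / 2 = \sum_u mub j u * (e / 2) by rewrite -mulr_suml (dmub j).2 mul1r.
    rewrite /g' opprK -sum_mul_swap -sumrB/= -big_split/=.
    by apply: eq_bigr => u _; rewrite /Z mulrDr mulrBr.
  by move=> ->; have := hx j v; lra.
rewrite /Z lerD2r lerD2l -sumrN; apply: ler_sum => j _; rewrite -mulrN.
by apply: ler_wpM2l => //; apply: le_trans (mmZ j) _; lra.
Qed.

(** Pair the minimizer's saddle strategies for [Q] with the maximizer's for [Q']. The values x and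
    x' satisfy opposite Bellman inequalities for this pair, so its cost is finite and it is not
    prolonging. The difference x' - x is then subharmonic for a chain losing half its mass in N
    steps, and cannot be positive at its maximum. *)
Lemma Fop_fixpoint_le (Q Q' : SA U V -> R) :
  Fop p ghat Q = Q -> Fop p ghat Q' = Q' -> forall l, Q' l <= Q l.
Proof.
move=> FQ FQ'; have [u0 v0] := SSP_inhabited.
pose x j := mmval Q (Some j); pose x' j := mmval Q' (Some j).
have QE l : Q l = gexp p ghat l + \sum_j p l (Some j) * x j by rewrite -{1}FQ.
have Q'E l : Q' l = gexp p ghat l + \sum_j p l (Some j) * x' j by rewrite -{1}FQ'.
have mu_ex j : {rho : U j -> R | is_dist rho /\
    forall v, \sum_u rho u * Q (triple u v) <= x j}.
  apply: cid; have [rho [_ [d1 _ h _]]] :=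
    infsup_saddle (fun u v => Q (triple u v)) (u0 j) (v0 j).
  by exists rho.
have nu_ex j : {sig : V j -> R | is_dist sig /\
    forall u, x' j <= \sum_v sig v * Q' (triple u v)}.
  apply: cid; have [_ [sig [_ d1 _ h]]] :=
    infsup_saddle (fun u v => Q' (triple u v)) (u0 j) (v0 j).
  by exists sig.
pose mu j := sval (mu_ex j); pose nu j := sval (nu_ex j).
have dmu : is_srpolU mu by move=> j; exact: (svalP (mu_ex j)).1.
have dnu : is_srpolU nu by move=> j; exact: (svalP (nu_ex j)).1.
have hx i : gmn p ghat mu nu i + \sum_j Pmn p mu nu i j * x j <= x i.
  rewrite gmnE' Pmn_apply exchange_big /= -big_split/=.
  apply: (@le_trans _ _ (\sum_v nu i v * \sum_u mu i u * Q (triple u v))).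
    apply: ler_sum => v _; rewrite !mulr_sumr -big_split/=; apply: ler_sum => u _.
    by rewrite QE; rewrite le_eqVlt; apply/orP; left; apply/eqP; ring.
  apply: is_dist_avg_le => // v; exact: (svalP (mu_ex i)).2.
have hx' i : x' i <= gmn p ghat mu nu i + \sum_j Pmn p mu nu i j * x' j.
  rewrite gmnE Pmn_apply -big_split/=.
  apply: (@le_trans _ _ (\sum_u mu i u * \sum_v nu i v * Q' (triple u v))).
    by apply: is_dist_avg_ge => // u; exact: (svalP (nu_ex i)).2.
  apply: ler_sum => u _; rewrite !mulr_sumr -big_split/=; apply: ler_sum => v _.
  by rewrite Q'E; rewrite le_eqVlt; apply/orP; left; apply/eqP; ring.
have [N hN] := nonprolonging_half p0 p1 dmu dnu
  (finite_cost_nonprolonging dmu dnu (Jsr_lt_pinfty p0 p1 dmu dnu hx)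
    (Jsr_gt_ninfty p0 p1 dmu dnu hx')).
pose d i := x' i - x i.
have hd i : d i <= \sum_j Pmn p mu nu i j * d j.
  under eq_bigr do rewrite mulrBr.
  by rewrite sumrB /d; have := hx i; have := hx' i; lra.
have hdk k i : d i <= \sum_j kstep p mu nu k i j * d j.
  elim: k i => [|k IH] i; first by rewrite kstep0.
  by apply: le_trans (IH i) _; rewrite kstepS; exact: kstep_mono.
have x'x i : x' i <= x i.
  rewrite -subr_le0 -/(d i) leNgt; apply/negP => di.
  case: (@Order.TotalTheory.arg_maxP _ _ _ i xpredT d isT) => i0 _ imax.
  have di0 : 0 < d i0 by exact: lt_le_trans (imax i isT).
  have : d i0 <= 2^-1 * d i0.
    apply: le_trans (hdk N i0) _.
    apply: (@le_trans _ _ (\sum_j kstep p mu nu N i0 j * d i0)).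
      by apply: kstep_mono => // j; exact: imax.
    by rewrite -mulr_suml ler_wpM2r// ltW.
  lra.
move=> l; rewrite QE Q'E lerD2l; apply: ler_sum => j _.
by rewrite ler_wpM2l.
Qed.

(** The sign of c matters at termination, where both values are 0. *)
Lemma mmval_le_shift (q q' : SA U V -> R) c j : 0 <= c ->
  (forall l, q l <= q' l + c) -> mmval q j <= mmval q' j + c.
Proof.
move=> c0 qq'; case: j => [j|]; last by rewrite /= add0r.
have [u0 v0] := SSP_inhabited.
by apply: (infsup_le_shift (u0 j) (v0 j)) => u v; exact: qq'.
Qed.

(** Exhibits [Fop] as the mean of the sampled target over all successors, termination included. *)
Lemma Fop_avg (q : SA U V -> R) l :
  Fop p ghat q l = \sum_j p l j * (ghat l j + mmval q j).
Proof.
rewrite /Fop /gexp !sum_option /= addr0 -addrA -big_split/=.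
by congr (_ + _); apply: eq_bigr => j _; rewrite mulrDr.
Qed.

End game.

(** * Strict sub- and supersolutions *)

(** Monotonicity (c = 0) and sup-norm nonexpansiveness in one property. The two index types differ
    so that it covers [mmval] as well as [Fop]. *)
Definition shift_monotone (R : realType) (L J : Type)
    (F : (L -> R) -> J -> R) : Prop :=
  forall q q' c, 0 <= c -> (forall l, q l <= q' l + c) ->
  forall j, F q j <= F q' j + c.

(** Conjugation by negation exchanges super- and subsolutions, so each lower bound below follows
    from the matching upper bound. *)
Lemma shift_monotoneN (R : realType) (L J : Type) (F : (L -> R) -> J -> R) :
  shift_monotone F -> shift_monotone (fun q j => - F (fun l => - q l) j).
Proof.
move=> Fm q q' c c0 qq' j.
suff: F (fun l => - q' l) j <= F (fun l => - q l) j + c by lra.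
by apply: Fm => // l; have := qq' l; lra.
Qed.

(** Perron's method: strict supersolutions are stable under pointwise minimum, so, [L] being finite,
    a single one approximates their infimum at all coordinates. *)
Lemma fixpoint_from_above (R : realType) (L : finType) (F : (L -> R) -> L -> R)
    (Y Z : L -> R) (e e' : R) : shift_monotone F ->
  0 < e -> (forall l, F Z l + e <= Z l) ->
  0 < e' -> (forall l, Y l + e' <= F Y l) ->
  exists Q, (forall l, F Q l = Q l) /\
    forall eta, 0 < eta -> exists z d, [/\ 0 < d,
      forall l, F z l + d <= z l & forall l, z l <= Q l + eta].
Proof.
move=> Fm e0 FZ e'0 FY.
have F_le q q' : (forall l, q l <= q' l) -> forall l, F q l <= F q' l.
  move=> qq' l; rewrite -[leRHS]addr0; apply: Fm => // k.
  by rewrite addr0.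
pose D : set (L -> R) := [set z | exists2 d, 0 < d & forall l, F z l + d <= z l].
have DZ : D Z by exists e.
have Ylb z : D z -> forall l, Y l <= z l.
  (* Where Y - z is largest and positive, shift monotonicity gives F Y - F z <= Y - z, which the two
     margins contradict. *)
  move=> [d d0 Fz] l; rewrite leNgt; apply/negP => zY.
  case: (@Order.TotalTheory.arg_maxP _ _ _ l xpredT (fun l => Y l - z l) isT) => l0 _ lmax.
  have := lmax l isT => /= c0.
  have : F Y l0 <= F z l0 + (Y l0 - z l0).
    by apply: Fm => [|k]; [lra|have := lmax k isT => /=; lra].
  by have := FY l0; have := Fz l0; lra.
pose Q l := inf [set z l | z in D].
have lbD l : has_lbound [set z l | z in D].
  by exists (Y l) => _ [z Dz <-]; exact: Ylb.
have Qle z l : D z -> Q l <= z l by move=> Dz; apply: ge_inf => //; exists z.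
have Dmin z1 z2 : D z1 -> D z2 -> D (fun l => Num.min (z1 l) (z2 l)).
  move=> [d1 d10 h1] [d2 d20 h2]; exists (Num.min d1 d2); first by rewrite lt_min d10.
  move=> l; rewrite le_min; apply/andP; split.
    apply: le_trans (h1 l); apply: lerD; last by rewrite ge_min lexx.
    by apply: F_le => k; rewrite ge_min lexx.
  apply: le_trans (h2 l); apply: lerD; last by rewrite ge_min lexx orbT.
  by apply: F_le => k; rewrite ge_min lexx orbT.
have approx eta : 0 < eta -> exists2 z, D z & forall l, z l <= Q l + eta.
  move=> eta0.
  suff [z Dz hz] : exists2 z, D z & forall l, l \in enum L -> z l <= Q l + eta.
    by exists z => // l; apply: hz; rewrite mem_enum.
  elim: (enum L) => [|l s [z Dz hz]]; first by exists Z.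
  have [|_ [z' Dz' <-] hz'] := @inf_adherent _ [set z l | z in D] _ eta0.
    by split; [exists (Z l), Z|exact: lbD].
  exists (fun l => Num.min (z l) (z' l)); first exact: Dmin.
  move=> k; rewrite inE => /orP[/eqP ->|ks].
    by rewrite ge_min (ltW hz') orbT.
  by rewrite ge_min (hz k ks).
exists Q; split=> [l|eta eta0]; last first.
  by have [z [d d0 Fz] hz] := approx _ eta0; exists z, d.
apply/eqP; rewrite eq_le; apply/andP; split.
  apply: lb_le_inf => [|_ [z Dz <-]]; first by exists (Z l), Z.
  have [d d0 Fz] := Dz.
  apply: (@le_trans _ _ (F z l)); last by have := Fz l; lra.
  by apply: F_le => k; exact: Qle.
apply/ler_addgt0Pr => eta eta0.
have eta2 : 0 < eta / 2 by rewrite divr_gt0.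
have [z [d d0 Fz] hz] := approx _ eta2.
(* With d' <= d the vector F z + d' lies below z, hence is again a strict supersolution and
   dominates Q; d' <= eta/2 keeps the error small. *)
pose d' := Num.min d (eta / 2).
have d'0 : 0 < d' by rewrite lt_min d0.
have d'd : d' <= d by rewrite ge_min lexx.
have d'eta : d' <= eta / 2 by rewrite ge_min lexx orbT.
have : Q l <= F z l + d'.
  apply: (Qle (fun l => F z l + d')); exists d' => // k; rewrite lerD2r.
  by apply: F_le => m; have := Fz m; lra.
have : F z l <= F Q l + eta / 2 by apply: Fm => //; exact: ltW.
lra.
Qed.

Lemma fixpoint_from_below (R : realType) (L : finType) (F : (L -> R) -> L -> R)
    (Y Z : L -> R) (e e' : R) : shift_monotone F ->
  0 < e -> (forall l, F Z l + e <= Z l) ->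
  0 < e' -> (forall l, Y l + e' <= F Y l) ->
  exists Q, (forall l, F Q l = Q l) /\
    forall eta, 0 < eta -> exists z d, [/\ 0 < d,
      forall l, z l + d <= F z l & forall l, Q l <= z l + eta].
Proof.
move=> Fm e0 FZ e'0 FY.
have NN (q : L -> R) : (fun l => - (- q l)) = q by apply/funext => l; rewrite opprK.
have [||Q [FQ hQ]] := @fixpoint_from_above R L _ (fun l => - Z l) (fun l => - Y l) e' e
    (shift_monotoneN Fm) e'0 _ e0 _.
- by move=> l; rewrite NN; have := FY l; lra.
- by move=> l; rewrite NN; have := FZ l; lra.
exists (fun l => - Q l); split=> [l|eta eta0].
  by have /= := FQ l; lra.
have [z [d [d0 hz zQ]]] := hQ eta eta0.
exists (fun l => - z l), d; split=> // l; first by have := hz l; lra.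
by have := zQ l; lra.
Qed.

Lemma eventually_all (L : finType) (P : L -> nat -> Prop) :
  (forall l, exists t0, forall t, (t0 <= t)%N -> P l t) ->
  exists t0, forall t, (t0 <= t)%N -> forall l, P l t.
Proof.
move=> /choice[f hf]; exists (\max_l f l) => t ft l; apply: hf.
exact: leq_trans (leq_bigmax l) ft.
Qed.

(** By convexity D stays below c + d once it gets there. Otherwise each step lowers D by at least d
    times the stepsize, which divergence of the stepsizes forbids. *)
Lemma relaxation_le (R : realType) (g D : nat -> R) (c : R) (t0 : nat) :
  (forall t, 0 <= g t <= 1) -> (forall B, exists m, B <= \sum_(k < m) g k) ->
  (forall t, (t0 <= t)%N -> D t.+1 <= (1 - g t) * D t + g t * c) ->
  forall d, 0 < d -> exists t1, forall t, (t1 <= t)%N -> D t <= c + d.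
Proof.
move=> g01 gsum hD d d0.
have [[t1 t01 Dt1]|no] : (exists2 t1, (t0 <= t1)%N & D t1 <= c + d) \/
    ~ (exists2 t1, (t0 <= t1)%N & D t1 <= c + d) by exact: EM.
  exists t1 => t /subnK <-; elim: (t - t1)%N => // k IH; rewrite addSn.
  apply: le_trans (hD _ _) _; first by rewrite (leq_trans t01)// leq_addl.
  have /andP[g0 g1] := g01 (k + t1)%N.
  have := ler_wpM2l (_ : 0 <= 1 - g (k + t1)%N) IH; rewrite subr_ge0 => /(_ g1).
  by have := mulr_ge0 g0 (ltW d0); lra.
exfalso.
have Dgt t : (t0 <= t)%N -> c + d < D t.
  by move=> tt0; rewrite ltNge; apply/negP => Dt; apply: no; exists t.
have dec m : d * \sum_(k < m) g (k + t0)%N <= D t0 - D (m + t0)%N.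
  elim: m => [|m IH]; first by rewrite big_ord0 mulr0 add0n subrr.
  rewrite big_ord_recr /= mulrDr addSn.
  have := hD (m + t0)%N (leq_addl _ _); have := Dgt (m + t0)%N (leq_addl _ _).
  have /andP[gm0 _] := g01 (m + t0)%N => Dm.
  have := ler_wpM2l gm0 (ltW Dm); lra.
have [m hm] := gsum ((D t0 - c) / d + \sum_(k < t0) g k).
have : \sum_(k < m) g k <= \sum_(k < t0) g k + \sum_(k < m) g (k + t0)%N.
  have : \sum_(k < m) g k <= \sum_(k < m + t0) g k.
    elim: t0 {no hD Dgt dec hm} => [|t IH]; first by rewrite addn0.
    by rewrite addnS big_ord_recr/=; have /andP[] := g01 (m + t)%N; lra.
  move=> h; apply: le_trans h _.
  by rewrite addnC big_split_ord/= lerD2l; under [leRHS]eq_bigr do rewrite addnC.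
move=> h; have : (D t0 - c) / d <= \sum_(k < m) g (k + t0)%N by lra.
rewrite ler_pdivrMr// mulrC => {}h.
by have := dec m; have := Dgt (m + t0)%N (leq_addl _ _); lra.
Qed.

(** * Comparison of delayed iterates along one sample path *)

Section pathwise.
Variables (R : realType) (L J : finType).
Variables (g : nat -> L -> R) (tau : nat -> L -> L -> nat) (s : nat -> L -> J).
Variables (p : L -> J -> R) (W : L -> J -> nat -> R).
Hypothesis g01 : forall t l, 0 <= g t l <= 1.
Hypothesis tau_le : forall t l l', (tau t l l' <= t)%N.
Hypothesis gsum : forall l B, exists m, B <= \sum_(k < m) g k l.
Hypothesis tau_infty : forall l l' N, exists t0, forall t, (t0 <= t)%N -> (N <= tau t l l')%N.
Hypothesis WS : forall l j t,
  W l j t.+1 = (1 - g t l) * W l j t + g t l * ((s t l == j)%:R - p l j).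
Hypothesis W0 : forall l j d, 0 < d ->
  exists t0, forall t, (t0 <= t)%N -> `|W l j t| <= d.

(* With [N] the noise driven by the frozen vector [H Z], the difference
   [Q - Z - N] satisfies a noiseless relaxation inequality. *)
Lemma eventually_le_supersolution (h : L -> J -> R) (H : (L -> R) -> J -> R)
    (Q : nat -> L -> R) (Z : L -> R) (e : R) : shift_monotone H ->
  (forall t l, Q t.+1 l = (1 - g t l) * Q t l +
     g t l * (h l (s t l) + H (fun l' => Q (tau t l l') l') (s t l))) ->
  0 < e -> (forall l, \sum_j p l j * (h l j + H Z j) + e <= Z l) ->
  exists t0, forall t, (t0 <= t)%N -> forall l, Q t l <= Z l.
Proof.
move=> Hm QS e0 FZ.
pose N l t := \sum_j W l j t * (h l j + H Z j).
have NS l t : N l t.+1 = (1 - g t l) * N l t +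
    g t l * (h l (s t l) + H Z (s t l) - \sum_j p l j * (h l j + H Z j)).
  have -> : h l (s t l) + H Z (s t l) = \sum_j (s t l == j)%:R * (h l j + H Z j).
    rewrite (bigD1 (s t l))//= eqxx mul1r big1 ?addr0// => j.
    by rewrite eq_sym => /negPf ->; rewrite mul0r.
  rewrite -sumrB !mulr_sumr -big_split/=; apply: eq_bigr => j _.
  by rewrite WS; ring.
have N0 d : 0 < d -> exists t0, forall t, (t0 <= t)%N -> forall l, `|N l t| <= d.
  move=> d0; pose M := \sum_l \sum_j `|h l j + H Z j|.
  have M0 : 0 <= M by apply: sumr_ge0 => l _; exact: sumr_ge0.
  have dM : 0 < d / (M + 1) by rewrite divr_gt0// ltr_wpDl.
  have [t0 ht0] := @eventually_all (L * J)%type (fun lj t => `|W lj.1 lj.2 t| <= d / (M + 1))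
    (fun lj => W0 lj.1 lj.2 dM).
  exists t0 => t tt0 l; apply: le_trans (ler_norm_sum _ _ _) _.
  apply: (@le_trans _ _ (d / (M + 1) * \sum_j `|h l j + H Z j|)).
    rewrite mulr_sumr; apply: ler_sum => j _; rewrite normrM ler_wpM2r//.
    exact: (ht0 t tt0 (l, j)).
  apply: (@le_trans _ _ (d / (M + 1) * M)).
    rewrite ler_wpM2l ?(ltW dM)// /M (bigD1 l)//= lerDl.
    by apply: sumr_ge0 => k _; exact: sumr_ge0.
  by rewrite mulrAC ler_pdivrMr ?ltr_wpDl// ler_wpM2l ?(ltW d0)// lerDl.
have step t l c : 0 <= c -> (forall l', Q (tau t l l') l' <= Z l' + c) ->
    Q t.+1 l - Z l - N l t.+1 <=
    (1 - g t l) * (Q t l - Z l - N l t) + g t l * (c - e).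
  move=> c0 hc; have /andP[gt0 gt1] := g01 t l.
  have := ler_wpM2l gt0 (Hm _ _ _ c0 hc (s t l)).
  have := ler_wpM2l gt0 (FZ l).
  rewrite QS NS; lra.
(* Boundedness: c covers the times up to [t0], after which the noise is at most e. The invariant
   bounds Q by Z + c at all past times, as delayed arguments require, and keeps Q - Z - N <= c - e,
   so that the drift absorbs the noise. *)
have [c0 c00 hc0] : exists2 c, 0 <= c & forall t l, Q t l <= Z l + c.
  have [t0 ht0] := N0 e e0.
  have [c1 c11 hc1] := finite_ub (fun tl : 'I_t0.+1 * L => Q tl.1 tl.2 - Z tl.2).
  have [c2 c22 hc2] := finite_ub (fun tl : 'I_t0.+1 * L => N tl.2 tl.1).
  pose c := c1 + c2 + e; exists c; first by rewrite /c; lra.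
  have c_ge0 : 0 <= c by rewrite /c; lra.
  suff inv t : (forall k l, (k <= t)%N -> Q k l <= Z l + c) /\
      ((t0 <= t)%N -> forall l, Q t l - Z l - N l t <= c - e).
    by move=> t l; apply: (inv t).1.
  have small k l (kt0 : (k < t0.+1)%N) : Q k l - Z l <= c1 /\ - N l k <= c2.
    have := hc1 (Ordinal kt0, l); have := hc2 (Ordinal kt0, l); rewrite !ler_norml /=.
    by move=> /andP[n1 _] /andP[_ n2]; split=> //; lra.
  elim: t => [|t [IH1 IH2]].
    split=> [k l|]; first by rewrite leqn0 => /eqP ->; have [] := small 0 l isT; rewrite /c; lra.
    by rewrite leqn0 => /eqP t00 l; have [] := small 0 l isT; rewrite /c; lra.
  have D : (t0 <= t.+1)%N -> forall l, Q t.+1 l - Z l - N l t.+1 <= c - e.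
    rewrite leq_eqVlt => /orP[/eqP tt0 l|tt0 l].
      have tt : (t.+1 < t0.+1)%N by rewrite tt0.
      by have [] := small _ l tt; rewrite /c; lra.
    have /andP[gt0 gt1] := g01 t l.
    have := step t l c c_ge0 (fun l' => IH1 _ _ (tau_le t l l')).
    have := ler_wpM2l (_ : 0 <= 1 - g t l) (IH2 tt0 l).
    by rewrite subr_ge0 => /(_ gt1); lra.
  split=> // k l; rewrite leq_eqVlt ltnS => /orP[/eqP ->|]; last exact: IH1.
  have [tt0|tt0] := leqP t0 t.+1.
    by have := D tt0 l; have := ht0 _ tt0 l; rewrite ler_norml => /andP[]; lra.
  by have [] := small _ l (leqW tt0); rewrite /c; lra.
(* One round gains e/2: the drift gives c - e, and e/4 is spent on the relaxation and e/4 on the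
   noise. The maximum with 0 is there because [step] needs a nonnegative c. *)
have descend c : 0 <= c ->
    (exists t0, forall t, (t0 <= t)%N -> forall l, Q t l <= Z l + c) ->
    exists t0, forall t, (t0 <= t)%N -> forall l, Q t l <= Z l + Num.max 0 (c - e / 2).
  move=> c_ge0 [t0 ht0].
  have [t1 ht1] := @eventually_all (L * L)%type (fun ll t => (t0 <= tau t ll.1 ll.2)%N)
    (fun ll => tau_infty ll.1 ll.2 t0).
  have e4 : 0 < e / 4 by rewrite divr_gt0.
  have [t2 ht2] := N0 _ e4.
  have [t3 ht3] := @eventually_all L (fun l t => Q t l - Z l - N l t <= c - e + e / 4)
    (fun l => relaxation_le (g01^~ l) (@gsum l) (fun t tt1 => @step t l c c_ge0
       (fun l' => ht0 _ (ht1 t tt1 (l, l')) l')) e4).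
  exists (maxn t2 t3) => t; rewrite geq_max => /andP[tt2 tt3] l.
  rewrite -lerBlDl le_max; apply/orP; right.
  by have := ht3 _ tt3 l; have := ht2 _ tt2 l; rewrite ler_norml => /andP[_]; lra.
have iter k : exists t0, forall t, (t0 <= t)%N -> forall l,
    Q t l <= Z l + Num.max 0 (c0 - k%:R * (e / 2)).
  elim: k => [|k IH].
    by exists 0%N => t _ l; rewrite mul0r subr0 max_r.
  have [|t0 ht0] := descend _ _ IH; first by rewrite le_max lexx.
  exists t0 => t tt0 l; apply: le_trans (ht0 t tt0 l) _; rewrite lerD2l.
  rewrite ge_max le_max lexx /= -[k.+1%:R]natr1 mulrDl mul1r.
  move: (k%:R * (e / 2)) => x.
  by case: (leP 0 (c0 - x)) => hx; rewrite le_max; apply/orP; [right|left]; lra.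
have [t0 ht0] := iter (Num.truncn (c0 / (e / 2))).+1.
exists t0 => t tt0 l; have := ht0 t tt0 l.
rewrite max_l ?addr0// subr_le0 -ler_pdivrMr ?divr_gt0//.
by apply: ltW; exact: truncnS_gt.
Qed.

Lemma eventually_ge_subsolution (h : L -> J -> R) (H : (L -> R) -> J -> R)
    (Q : nat -> L -> R) (Y : L -> R) (e : R) : shift_monotone H ->
  (forall t l, Q t.+1 l = (1 - g t l) * Q t l +
     g t l * (h l (s t l) + H (fun l' => Q (tau t l l') l') (s t l))) ->
  0 < e -> (forall l, Y l + e <= \sum_j p l j * (h l j + H Y j)) ->
  exists t0, forall t, (t0 <= t)%N -> forall l, Y l <= Q t l.
Proof.
move=> Hm QS e0 FY.
have NN (q : L -> R) : (fun l => - (- q l)) = q by apply/funext => l; rewrite opprK.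
have [| |t0 ht0] := @eventually_le_supersolution (fun l j => - h l j) _
    (fun t l => - Q t l) (fun l => - Y l) e (shift_monotoneN Hm) _ e0 _.
- by move=> t l; rewrite QS NN; ring.
- move=> l; rewrite NN; under eq_bigr do rewrite -opprD mulrN.
  by rewrite sumrN; have := FY l; lra.
by exists t0 => t tt0 l; rewrite -lerN2; exact: ht0.
Qed.

End pathwise.

(** * Integration of bounded functions and sub-sigma-algebras *)

Section sub_sigma_algebra.
Context d (T : measurableType d) (R : realType) (G : set (set T)).
Hypothesis HG : sigma_algebra setT G.
Implicit Types (f g : T -> R) (A : set T).

(** Since [G] equals the sigma-algebra it generates, closure properties transfer from
    [measurable_fun]. *)
Lemma rmeas_wrtP f :
  rmeas_wrt G f <-> measurable_fun setT (f : g_sigma_algebraType G -> R).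
Proof.
have E : @measurable _ (g_sigma_algebraType G) = G := sigma_algebra_id HG.
split=> [Gf _ B mB|mf B mB].
  by rewrite setTI E; exact: Gf.
by have := mf measurableT B mB; rewrite setTI E.
Qed.

Lemma rmeas_wrt_cst (c : R) : rmeas_wrt G (fun=> c).
Proof. by apply/rmeas_wrtP; exact: measurable_cst. Qed.

Lemma rmeas_wrtD f g : rmeas_wrt G f -> rmeas_wrt G g ->
  rmeas_wrt G (fun w => f w + g w).
Proof.
by move=> /rmeas_wrtP mf /rmeas_wrtP mg; apply/rmeas_wrtP; exact: measurable_funD.
Qed.

Lemma rmeas_wrtM f g : rmeas_wrt G f -> rmeas_wrt G g ->
  rmeas_wrt G (fun w => f w * g w).
Proof.
by move=> /rmeas_wrtP mf /rmeas_wrtP mg; apply/rmeas_wrtP; exact: measurable_funM.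
Qed.

Lemma rmeas_wrtB f g : rmeas_wrt G f -> rmeas_wrt G g ->
  rmeas_wrt G (fun w => f w - g w).
Proof.
by move=> /rmeas_wrtP mf /rmeas_wrtP mg; apply/rmeas_wrtP; exact: measurable_funB.
Qed.

Lemma rmeas_wrt_sum (I : Type) (s : seq I) (Q : pred I) (f : I -> T -> R) :
  (forall i, Q i -> rmeas_wrt G (f i)) -> rmeas_wrt G (fun w => \sum_(i <- s | Q i) f i w).
Proof.
move=> mf; elim: s => [|i s IH].
  by under eq_fun do rewrite big_nil; exact: rmeas_wrt_cst.
under eq_fun do rewrite big_cons.
by have [Qi|_] := boolP (Q i); [apply: rmeas_wrtD => //; exact: mf|exact: IH].
Qed.

Lemma rmeas_wrt_le f g : rmeas_wrt G f -> rmeas_wrt G g ->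
  G [set w | f w <= g w].
Proof.
move=> /rmeas_wrtP mf /rmeas_wrtP mg.
have := @measurable_fun_le _ (g_sigma_algebraType G) R setT _ _ measurableT mf mg.
by rewrite setTI; have -> : @measurable _ (g_sigma_algebraType G) = G := sigma_algebra_id HG.
Qed.

Lemma sub_sigma_algebraC A : G A -> G (~` A).
Proof. by move=> GA; rewrite -setTD; case: HG => _ + _; apply. Qed.

Lemma sub_sigma_algebraT : G setT.
Proof. by rewrite -setC0; apply: sub_sigma_algebraC; case: HG. Qed.

Lemma sub_sigma_algebra_bigcap (A : nat -> set T) :
  (forall k, G (A k)) -> G (\bigcap_k A k).
Proof.
move=> GA; rewrite -[X in G X]setCK setC_bigcap; apply: sub_sigma_algebraC.
by case: HG => _ _; apply => k; exact: sub_sigma_algebraC.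
Qed.

Lemma rmeas_wrt_indic A : G A -> rmeas_wrt G (\1_A : T -> R).
Proof.
move=> GA; apply/rmeas_wrtP; apply: (@measurable_indic _ (g_sigma_algebraType G)).
by have -> : @measurable _ (g_sigma_algebraType G) = G := sigma_algebra_id HG.
Qed.

End sub_sigma_algebra.

Section bounded_measurable.
Context d (T : measurableType d) (R : realType) (P : probability T R).
Implicit Types f g : T -> R.

Definition bounded_measurable f :=
  measurable_fun setT f /\ exists M, forall w, `|f w| <= M.

Lemma bounded_measurable_integrable f : bounded_measurable f ->
  P.-integrable setT (EFin \o f).
Proof.
move=> [mf [M fM]]; apply: measurable_bounded_integrable => //.
  by apply: le_lt_trans (ltry 1); exact: probability_le1.
by exists M; split=> [|x Mx w _]; [exact: num_real|exact: le_trans (fM w) (ltW Mx)].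
Qed.

Lemma bounded_measurable_cst (c : R) : bounded_measurable (fun=> c).
Proof. by split; [exact: measurable_cst|exists `|c|]. Qed.

Lemma bounded_measurable_indic (A : set T) : measurable A ->
  bounded_measurable (\1_A).
Proof.
move=> mA; split; first exact: measurable_indic.
by exists 1 => w; rewrite indicE; case: (w \in A); rewrite ?normr1 ?normr0.
Qed.

Lemma bounded_measurableD f g : bounded_measurable f -> bounded_measurable g ->
  bounded_measurable (fun w => f w + g w).
Proof.
move=> [mf [M fM]] [mg [N gN]]; split; first exact: measurable_funD.
by exists (M + N) => w; apply: le_trans (ler_normD _ _) _; exact: lerD.
Qed.

Lemma bounded_measurableM f g : bounded_measurable f -> bounded_measurable g ->
  bounded_measurable (fun w => f w * g w).
Proof.
move=> [mf [M fM]] [mg [N gN]]; split; first exact: measurable_funM.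
by exists (M * N) => w; rewrite normrM; exact: ler_pM.
Qed.

Lemma bounded_measurableZ (c : R) f : bounded_measurable f ->
  bounded_measurable (fun w => c * f w).
Proof. exact/bounded_measurableM/bounded_measurable_cst. Qed.

Lemma bounded_measurableB f g : bounded_measurable f -> bounded_measurable g ->
  bounded_measurable (fun w => f w - g w).
Proof.
move=> mf /(bounded_measurableZ (-1)) mg.
by have := bounded_measurableD mf mg; under eq_fun do rewrite mulN1r.
Qed.

Lemma bounded_measurable_sum (I : Type) (s : seq I) (f : I -> T -> R) :
  (forall i, bounded_measurable (f i)) ->
  bounded_measurable (fun w => \sum_(i <- s) f i w).
Proof.
move=> mf; elim: s => [|i s IH].
  by under eq_fun do rewrite big_nil; exact: bounded_measurable_cst.
under eq_fun do rewrite big_cons.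
by apply: bounded_measurableD => //; exact: mf.
Qed.

Local Notation EX f := (Rintegral P setT f).

Lemma EX_D f g : bounded_measurable f -> bounded_measurable g ->
  EX (fun w => f w + g w) = EX f + EX g.
Proof. by move=> mf mg; rewrite RintegralD//; exact: bounded_measurable_integrable. Qed.

Lemma EX_B f g : bounded_measurable f -> bounded_measurable g ->
  EX (fun w => f w - g w) = EX f - EX g.
Proof. by move=> mf mg; rewrite RintegralB//; exact: bounded_measurable_integrable. Qed.

Lemma EX_Z (c : R) f : bounded_measurable f -> EX (fun w => c * f w) = c * EX f.
Proof. by move=> mf; rewrite RintegralZl//; exact: bounded_measurable_integrable. Qed.

Lemma EX_le f g : bounded_measurable f -> bounded_measurable g ->
  (forall w, f w <= g w) -> EX f <= EX g.
Proof. by move=> mf mg fg; apply: le_Rintegral => //; exact: bounded_measurable_integrable. Qed.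

Lemma EX_cst (c : R) : EX (fun=> c) = c.
Proof. by rewrite Rintegral_cst// (congr1 fine (probability_setT P)) mulr1. Qed.

Lemma EX_sum (I : Type) (s : seq I) (f : I -> T -> R) :
  (forall i, bounded_measurable (f i)) ->
  EX (fun w => \sum_(i <- s) f i w) = \sum_(i <- s) EX (f i).
Proof.
move=> mf; elim: s => [|i s IH].
  by under eq_fun do rewrite big_nil; rewrite big_nil EX_cst.
under eq_fun do rewrite big_cons.
by rewrite EX_D ?IH ?big_cons//; exact: bounded_measurable_sum.
Qed.

Lemma EX_indic (A : set T) : measurable A -> EX \1_A = fine (P A).
Proof. by move=> mA; rewrite /Rintegral integral_indic// setIT. Qed.

(* [f] is within [del] of a [G]-measurable function with finitely many values,
   for which the claim is [condprob_eq] itself. *)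
Lemma condprob_eq_orthogonal (G : set (set T)) (E : set T) (c M : R) f :
  sigma_algebra setT G -> G `<=` measurable -> measurable E ->
  0 <= c <= 1 -> condprob_eq P G E c -> rmeas_wrt G f -> (forall w, `|f w| <= M) ->
  EX (fun w => f w * (\1_E w - c)) = 0.
Proof.
move=> HG Gm mE /andP[c0 c1] HE Gf fM.
have mf : bounded_measurable f.
  by split; [move=> _ B mB; rewrite setTI; exact/Gm/Gf|exists M].
have mxi : bounded_measurable (fun w => \1_E w - c).
  by apply: bounded_measurableB (bounded_measurable_cst c); exact: bounded_measurable_indic.
have xi1 w : `|\1_E w - c| <= 1.
  by rewrite ler_norml indicE; case: (w \in E); rewrite ?mulr1n ?mulr0n; lra.
have G0 A : G A -> EX (fun w => \1_A w * (\1_E w - c)) = 0.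
  move=> GA; have mA := Gm _ GA.
  have -> : (fun w => \1_A w * (\1_E w - c)) = (fun w => \1_(A `&` E) w - c * \1_A w).
    by apply/funext => w; rewrite indicI /=; ring.
  have mAE : measurable (A `&` E) by exact: measurableI.
  have bA := bounded_measurable_indic mA; have bAE := bounded_measurable_indic mAE.
  rewrite (EX_B bAE (bounded_measurableZ c bA)) (EX_Z c bA) !EX_indic//.
  by rewrite HE// fineM//= ?subrr// fin_num_measure.
have small del : 0 < del -> `|EX (fun w => f w * (\1_E w - c))| <= del.
  move=> del0.
  (* Quantization of f with mesh [del]: as |f / del| < K + 1, a shift by K + 2 makes the cell index
     nonnegative and smaller than N. *)
  pose K := Num.truncn (M / del); pose N := K.+2.*2.
  pose v (k : nat) : R := (k%:R - K.+2%:R) * del.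
  pose A k := f @^-1` `[v k, v k.+1[%classic.
  have GA k : G (A k) by exact: Gf.
  pose f' w := \sum_(k < N) v k * \1_(A k) w.
  have mf' : bounded_measurable f'.
    by apply: bounded_measurable_sum => k; exact/bounded_measurableZ/bounded_measurable_indic/Gm.
  have Av w k : A k w <-> k%:R <= f w / del + K.+2%:R < k.+1%:R.
    rewrite /A /= in_itv /= /v -ler_pdivlMr// -ltr_pdivrMr// lerBlDr ltrBrDr.
    by [].
  have close w : `|f w - f' w| <= del.
    have xlt : `|f w / del| < K.+1%:R.
      rewrite normrM [`|del^-1|]gtr0_norm ?invr_gt0//.
      by apply: le_lt_trans (truncnS_gt (M / del)); rewrite ler_pM2r ?invr_gt0.
    move: xlt; rewrite ltr_norml => /andP[xlo xhi].
    pose x := f w / del + K.+2%:R.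
    have x0 : 0 <= x by rewrite /x -[K.+2%:R]natr1; move: xlo; move: (f w / del) K.+1%:R => y c'; lra.
    have /andP[kx xk] := truncn_itv x0.
    set k := Num.truncn x in kx xk.
    have kN : (k < N)%N.
      rewrite -(ltr_nat R); apply: le_lt_trans kx _.
      rewrite /N -addnn natrD /x ltrD2r; apply: lt_trans xhi _.
      by rewrite ltr_nat.
    have -> : f' w = v k.
      rewrite /f' (bigD1 (Ordinal kN))//= big1 ?addr0 => [|j jk].
        by rewrite indicE mem_set ?mulr1//; apply/Av; rewrite kx.
      rewrite indicE memNset ?mulr0// => /Av /andP[jx xj].
      move/eqP: jk; apply; apply/val_inj => /=; apply/eqP; rewrite eqn_leq.
      apply/andP; split; rewrite -ltnS -(ltr_nat R).
        exact: le_lt_trans jx xk.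
      exact: le_lt_trans kx xj.
    have /Av : k%:R <= f w / del + K.+2%:R < k.+1%:R by rewrite kx.
    rewrite /A /= in_itv /= /v -[k.+1%:R]natr1 => /andP[vk kv].
    by rewrite ler_norml; lra.
  have f'0 : EX (fun w => f' w * (\1_E w - c)) = 0.
    under eq_fun do rewrite mulr_suml.
    rewrite EX_sum => [|k]; last first.
      apply: bounded_measurableM => //.
      exact/bounded_measurableZ/bounded_measurable_indic/Gm.
    rewrite big1// => k _; under eq_fun do rewrite -mulrA.
    rewrite EX_Z ?G0 ?mulr0//; apply: bounded_measurableM => //.
    exact/bounded_measurable_indic/Gm.
  have -> : EX (fun w => f w * (\1_E w - c)) = EX (fun w => (f w - f' w) * (\1_E w - c)).
    under [in RHS]eq_fun do rewrite mulrBl.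
    by rewrite EX_B ?f'0 ?subr0//; exact: bounded_measurableM.
  have mff' : bounded_measurable (fun w => (f w - f' w) * (\1_E w - c)).
    by apply: bounded_measurableM => //; exact: bounded_measurableB.
  have bnd w : `|(f w - f' w) * (\1_E w - c)| <= del.
    by rewrite normrM -[leRHS]mulr1; exact: ler_pM.
  rewrite ler_norml -(EX_cst (- del)) -{2}(EX_cst del); apply/andP; split.
    apply: (EX_le (bounded_measurable_cst _) mff') => w.
    by have := bnd w; rewrite ler_norml => /andP[].
  apply: (EX_le mff' (bounded_measurable_cst _)) => w.
  by have := bnd w; rewrite ler_norml => /andP[].
apply/eqP; rewrite -normr_eq0 eq_le normr_ge0 andbT.
by apply/ler_addgt0Pr => e e0; rewrite add0r; exact: small.
Qed.

End bounded_measurable.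

(** * Martingale transforms *)

(* [Y] is [M - M t0] stopped at its first exit of [(-sqrt e, sqrt e)]. *)
Lemma stopped_sum_exit (R : realType) (M Y : nat -> R) (B : nat -> Prop)
    (t0 : nat) (e : R) : 0 < e ->
  (forall k, B k <-> (t0 <= k)%N /\
     forall m, (t0 <= m <= k)%N -> (M m - M t0) ^+ 2 < e) ->
  Y 0 = 0 -> (forall k, B k -> Y k.+1 = Y k + (M k.+1 - M k)) ->
  (forall k, ~ B k -> Y k.+1 = Y k) ->
  forall t, (exists2 m, (t0 <= m <= t)%N & e <= (M m - M t0) ^+ 2) <->
    e <= (Y t) ^+ 2.
Proof.
move=> e0 HB Y0 YB YnB t.
pose hit t := exists2 m, (t0 <= m <= t)%N & e <= (M m - M t0) ^+ 2.
have nhit k : (t0 <= k)%N -> ~ hit k -> B k.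
  move=> tk nh; apply/HB; split=> // m mk; rewrite ltNge; apply/negP => em.
  by apply: nh; exists m.
(* Three regimes: Y is 0 before [t0], follows M - M t0 until the exit, and is frozen at the exit
   value afterwards. *)
suff [Ylt [Ynh Yh]] : ((t < t0)%N -> Y t = 0) /\
    ((t0 <= t)%N -> ~ hit t -> Y t = M t - M t0) /\ (hit t -> e <= (Y t) ^+ 2).
  split=> // eY; apply: contrapT => nh; move: (eY).
  have [tt0|t0t] := ltnP t t0; first by rewrite Ylt// expr0n/= leNgt e0.
  have [_ Bt] := (HB t).1 (nhit _ t0t nh).
  by rewrite Ynh// leNgt Bt// t0t /=.
elim: t => [|t [Ylt [Ynh Yh]]].
  split=> //; rewrite leqn0; split=> [/eqP -> _|]; first by rewrite Y0 subrr.
  move=> [m]; rewrite leqn0 => /andP[tm /eqP m0]; move: tm; rewrite m0 leqn0 => /eqP ->.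
  by rewrite subrr expr0n/= leNgt e0.
have [Bt|nBt] := EM (B t).
  have [t0t Bt'] := (HB t).1 Bt.
  have nh : ~ hit t by move=> [m mt]; rewrite leNgt Bt'.
  have YE : Y t.+1 = M t.+1 - M t0 by rewrite YB// Ynh//; ring.
  split=> [tt|]; first by move: (leq_trans tt t0t); rewrite ltnNge leqnSn.
  split=> // -[m /andP[tm]]; rewrite leq_eqVlt => /orP[/eqP ->|mt em]; first by rewrite YE.
  by case: nh; exists m; rewrite // tm.
rewrite YnB//; split=> [tt|]; first by apply: Ylt; exact: ltnW.
have [tt0|t0t] := ltnP t t0; last first.
  have ht : hit t by apply: contrapT => /(nhit _ t0t).
  split=> [_ nh|_]; last exact: Yh.
  by case: nh; have [m /andP[tm mt] em] := ht; exists m; rewrite // tm leqW.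
have tE : (t0 <= t.+1)%N -> t0 = t.+1 by move=> h; apply/eqP; rewrite eqn_leq h.
split=> [/tE <- _|[m /andP[tm mt]]]; first by rewrite Ylt// subrr.
have mE : m = t0 by apply/eqP; rewrite eqn_leq tm andbT (leq_trans mt).
by rewrite mE subrr expr0n/= leNgt e0.
Qed.

Section martingale.
Context d (T : measurableType d) (R : realType) (P : probability T R).
Variable Fs : nat -> set (set T).
Hypothesis HFsig : forall t, sigma_algebra setT (Fs t).
Hypothesis HFmeas : forall t, Fs t `<=` measurable.
Hypothesis HFinc : forall t, Fs t `<=` Fs t.+1.
Variables (E : nat -> set T) (c : R).
Hypothesis c01 : 0 <= c <= 1.
Hypothesis FE : forall t, Fs t.+1 (E t).
Hypothesis PE : forall t, condprob_eq P (Fs t) (E t) c.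
Implicit Type a : nat -> T -> R.

Local Notation EX f := (Rintegral P setT f).

Definition mtransform a m w := \sum_(k < m) a k w * (\1_(E k) w - c).

Lemma filtration_le s t : (s <= t)%N -> Fs s `<=` Fs t.
Proof.
by move=> /subnK <-; elim: (t - s)%N => // k IH A /IH; rewrite addSn; exact: HFinc.
Qed.

Lemma rmeas_wrt_sub G G' (f : T -> R) : G `<=` G' -> rmeas_wrt G f -> rmeas_wrt G' f.
Proof. by move=> GG' Gf B mB; exact/GG'/Gf. Qed.

Lemma noise_le1 t w : `|\1_(E t) w - c| <= 1.
Proof.
have /andP[c0 c1] := c01.
by rewrite ler_norml indicE; case: (w \in E t); rewrite ?mulr1n ?mulr0n; lra.
Qed.

Definition predictable a :=
  (forall t, rmeas_wrt (Fs t) (a t)) /\ forall t w, `|a t w| <= 1.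

Lemma mtransform_rmeas a m : predictable a -> rmeas_wrt (Fs m) (mtransform a m).
Proof.
move=> [ma _]; apply: rmeas_wrt_sum => // k _; apply: rmeas_wrtM => //.
  by apply: rmeas_wrt_sub (ma k); apply: filtration_le; exact: ltnW.
apply: rmeas_wrtB => //; last exact: rmeas_wrt_cst.
by apply: rmeas_wrt_indic => //; apply: (@filtration_le k.+1) (FE k).
Qed.

Lemma mtransform_le a m w : predictable a -> `|mtransform a m w| <= m%:R.
Proof.
move=> [_ a1]; apply: le_trans (ler_norm_sum _ _ _) _.
rewrite -[leRHS]mulr1 mulr_natl -[X in _ *+ X](card_ord m) -sumr_const.
apply: ler_sum => k _; rewrite normrM -[leRHS]mulr1.
by apply: ler_pM => //; exact: noise_le1.
Qed.

Lemma rmeas_wrt_bounded t (f : T -> R) M : rmeas_wrt (Fs t) f ->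
  (forall w, `|f w| <= M) -> bounded_measurable f.
Proof.
by move=> mf fM; split; [move=> _ B mB; rewrite setTI; exact/(@HFmeas t)/mf|exists M].
Qed.

(** The cross term vanishes by [condprob_eq_orthogonal], because the past transform times the
    current weight is bounded and known at time m; the squared noise is at most 1. *)
Lemma mtransform_second_moment a m : predictable a ->
  EX (fun w => mtransform a m w ^+ 2) <= \sum_(k < m) EX (fun w => a k w ^+ 2).
Proof.
move=> pa; have [ma a1] := pa; elim: m => [|m IH].
  rewrite big_ord0 /mtransform; under eq_fun do rewrite big_ord0 expr0n/=.
  by rewrite EX_cst.
have bX : bounded_measurable (mtransform a m).
  exact: rmeas_wrt_bounded (mtransform_rmeas m pa) (fun w => mtransform_le m w pa).
have ba : bounded_measurable (a m) by exact: rmeas_wrt_bounded (ma m) (a1 m).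
have bxi : bounded_measurable (fun w => \1_(E m) w - c).
  apply: bounded_measurableB (bounded_measurable_cst _ c).
  exact/bounded_measurable_indic/(@HFmeas m.+1).
have bX2 := bounded_measurableM bX bX.
have ba2 := bounded_measurableM ba ba.
have bXa := bounded_measurableM bX ba.
have bXax := bounded_measurableM bXa bxi.
have orth : EX (fun w => (mtransform a m w * a m w) * (\1_(E m) w - c)) = 0.
  apply: (@condprob_eq_orthogonal _ _ _ P (Fs m) (E m) c m%:R) => //.
  - exact: (@HFmeas m.+1).
  - by apply: rmeas_wrtM => //; exact: mtransform_rmeas.
  - move=> w; rewrite normrM -[leRHS]mulr1; apply: ler_pM => //.
    exact: mtransform_le.
rewrite big_ord_recr /=.
have b2Xax := bounded_measurableZ 2 bXax.
have bD1 := bounded_measurableD bX2 b2Xax.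
have -> : EX (fun w => a m w ^+ 2) = EX (fun w => a m w * a m w).
  by congr Rintegral; apply/funext => w; rewrite expr2.
have IH' : EX (fun w => mtransform a m w * mtransform a m w) <=
    \sum_(k < m) EX (fun w => a k w ^+ 2).
  by move: IH; under eq_fun do rewrite expr2.
suff : EX (fun w => mtransform a m.+1 w ^+ 2) <=
    EX (fun w => (mtransform a m w * mtransform a m w +
      2 * (mtransform a m w * a m w * (\1_(E m) w - c))) + a m w * a m w).
  by rewrite (EX_D P bD1 ba2) (EX_D P bX2 b2Xax) (EX_Z P _ bXax) orth; lra.
have bS : bounded_measurable (fun w => mtransform a m.+1 w ^+ 2).
  have bX' := rmeas_wrt_bounded (mtransform_rmeas m.+1 pa) (fun w => mtransform_le m.+1 w pa).
  by under eq_fun do rewrite expr2; exact: bounded_measurableM.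
apply: EX_le => // [|w]; first exact: bounded_measurableD.
rewrite /mtransform big_ord_recr /= -/(mtransform a m w).
move: (mtransform a m w) (a m w) (\1_(E m) w - c) (noise_le1 m w) => X y x x1.
have : (y * x) ^+ 2 <= y * y.
  rewrite exprMn -expr2 ler_piMr ?sqr_ge0// -real_normK ?num_real//.
  by rewrite expr_le1.
by rewrite !expr2; lra.
Qed.

Definition fluctuation a t0 t e :=
  [set w | exists2 m, (t0 <= m <= t)%N & e <= (mtransform a m w - mtransform a t0 w) ^+ 2].

(* Kolmogorov's maximal inequality: apply the second moment bound to the
   transform stopped at its first exit. *)
Lemma maximal_inequality a t0 t e : predictable a -> 0 < e ->
  measurable (fluctuation a t0 t e) /\
  e * fine (P (fluctuation a t0 t e)) <=
    \sum_(k < t | (t0 <= k)%N) EX (fun w => a k w ^+ 2).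
Proof.
move=> pa e0; have [ma a1] := pa.
(* No exit up to time k: this is decided at time k, so multiplying by its indicator keeps the
   weights predictable. *)
pose B k := [set w | (t0 <= k)%N /\ forall m, (t0 <= m <= k)%N ->
  (mtransform a m w - mtransform a t0 w) ^+ 2 < e].
have FB k : Fs k (B k).
  have [t0k|kt0] := leqP t0 k; last first.
    have -> : B k = set0; last by case: (HFsig k).
    by rewrite -subset0 => w [t0k _]; move: kt0; rewrite ltnNge t0k.
  have -> : B k = \bigcap_m (if (t0 <= m <= k)%N then
      ~` [set w | e <= (mtransform a m w - mtransform a t0 w) * (mtransform a m w - mtransform a t0 w)]
      else setT).
    apply/seteqP; split=> [w [_ Bw] m _|w Bw].
      by case: ifPn => // /Bw; rewrite expr2 ltNge => /negP.
    split=> // m mk; have := Bw m I; rewrite mk /= expr2 ltNge.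
    by move/negP.
  apply: sub_sigma_algebra_bigcap => // m; case: ifP => [/andP[t0m mk]|_].
    apply: sub_sigma_algebraC => //; apply: rmeas_wrt_le => //; first exact: rmeas_wrt_cst.
    have mX : rmeas_wrt (Fs k) (fun w => mtransform a m w - mtransform a t0 w).
      apply: rmeas_wrtB => //.
        exact: rmeas_wrt_sub (filtration_le mk) (mtransform_rmeas _ pa).
      exact: rmeas_wrt_sub (filtration_le t0k) (mtransform_rmeas _ pa).
    exact: rmeas_wrtM.
  exact: sub_sigma_algebraT.
pose b k w := a k w * \1_(B k) w.
have pb : predictable b.
  split=> [k|k w]; first by apply: rmeas_wrtM => //; exact: rmeas_wrt_indic.
  rewrite normrM -[leRHS]mulr1; apply: ler_pM => //.
  by rewrite indicE; case: (w \in B k); rewrite ?normr1 ?normr0.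
have SE : fluctuation a t0 t e =
    [set w | e <= mtransform b t w * mtransform b t w].
  apply/seteqP; split=> w; rewrite /fluctuation /= -expr2.
    move=> h; apply/(@stopped_sum_exit R (mtransform a ^~ w) (mtransform b ^~ w) (fun k => B k w) t0 e) => //.
    - by rewrite /mtransform big_ord0.
    - move=> k Bk; rewrite /mtransform !big_ord_recr /= /b indicE mem_set//.
      by rewrite mulr1; ring.
    - move=> k nBk; rewrite /mtransform big_ord_recr /= /b indicE memNset//.
      by rewrite mulr0 mul0r addr0.
  move=> h; apply/(@stopped_sum_exit R (mtransform a ^~ w) (mtransform b ^~ w) (fun k => B k w) t0 e) => //.
  - by rewrite /mtransform big_ord0.
  - move=> k Bk; rewrite /mtransform !big_ord_recr /= /b indicE mem_set//.
    by rewrite mulr1; ring.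
  - move=> k nBk; rewrite /mtransform big_ord_recr /= /b indicE memNset//.
    by rewrite mulr0 mul0r addr0.
have mY := mtransform_rmeas t pb.
have mS : measurable (fluctuation a t0 t e).
  rewrite SE; apply: (@HFmeas t); apply: rmeas_wrt_le => //; first exact: rmeas_wrt_cst.
  exact: rmeas_wrtM.
split=> //.
have bY := rmeas_wrt_bounded mY (fun w => mtransform_le t w pb).
have bS := bounded_measurable_indic R mS.
rewrite -EX_indic// -(EX_Z P e bS).
(* Chebyshev's inequality for the stopped transform. Its weights vanish before [t0], which restricts
   the final sum. *)
apply: (@le_trans _ _ (EX (fun w => mtransform b t w ^+ 2))).
  have bY2 : bounded_measurable (fun w => mtransform b t w ^+ 2).
    by under eq_fun do rewrite expr2; exact: bounded_measurableM.
  apply: (EX_le P (bounded_measurableZ e bS) bY2) => w.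
  rewrite indicE; case: (boolP (w \in _)) => [|_]; last by rewrite mulr0 sqr_ge0.
  by rewrite inE SE /= mulr1 expr2.
apply: le_trans (mtransform_second_moment t pb) _.
rewrite [leRHS]big_mkcond/=; apply: ler_sum => k _.
have ba2 (f : nat -> T -> R) j : predictable f -> bounded_measurable (fun w => f j w ^+ 2).
  move=> [mf f1]; have bf := rmeas_wrt_bounded (mf j) (f1 j).
  by under eq_fun do rewrite expr2; exact: bounded_measurableM.
case: ifPn => [t0k|kt0].
  apply: (EX_le P (ba2 b k pb) (ba2 a k pa)) => w.
  by rewrite /b exprMn ler_piMr ?sqr_ge0.
rewrite -(EX_cst P 0); apply: (EX_le P (ba2 b k pb) (bounded_measurable_cst _ 0)) => w.
by rewrite /b indicE memNset ?mulr0 ?expr0n//= => -[t0k _]; rewrite t0k in kt0.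
Qed.

(** The expected squared weights have partial sums bounded by N, so their tails are small. The
    maximal inequality passes to an infinite horizon by continuity from below, and [t0] can be
    chosen to make the probability arbitrarily small. *)
Lemma fluctuation_negligible a N e : predictable a ->
  (forall m w, \sum_(k < m) a k w ^+ 2 <= N) -> 0 < e ->
  P.-negligible [set w | forall t0, exists2 m, (t0 <= m)%N &
     e <= (mtransform a m w - mtransform a t0 w) ^+ 2].
Proof.
move=> pa aN e0; have [ma a1] := pa.
have ba2 k : bounded_measurable (fun w => a k w ^+ 2).
  have ba := rmeas_wrt_bounded (ma k) (a1 k).
  by under eq_fun do rewrite expr2; exact: bounded_measurableM.
pose s m := \sum_(k < m) EX (fun w => a k w ^+ 2).
have sN m : s m <= N.
  rewrite /s -EX_sum// -(EX_cst P N).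
  by apply: EX_le => //; [exact: bounded_measurable_sum|exact: bounded_measurable_cst].
have s_tail t0 t : (t0 <= t)%N ->
    s t = s t0 + \sum_(k < t | (t0 <= k)%N) EX (fun w => a k w ^+ 2).
  move=> t0t; rewrite /s (bigID (fun k : 'I_t => (t0 <= k)%N))/= addrC; congr (_ + _).
  rewrite (big_ord_widen t (fun k => EX (fun w => a k w ^+ 2)) t0t); apply: eq_bigl => k.
  by rewrite -ltnNge.
pose U t0 := \bigcup_t fluctuation a t0 (t0 + t) e.
have mF t0 t : measurable (fluctuation a t0 t e) by have [] := maximal_inequality t0 t pa e0.
have mU t0 : measurable (U t0) by apply: bigcupT_measurable => t; exact: mF.
have PU t0 B : (forall t, s (t0 + t)%N - s t0 <= B) -> (P (U t0) <= (B / e)%:E)%E.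
  move=> hB.
  have cv := @nondecreasing_cvg_mu _ _ _ P (fun t => fluctuation a t0 (t0 + t) e)
    (fun t => mF t0 (t0 + t)%N) (mU t0).
  have nd : {homo (fun t => fluctuation a t0 (t0 + t) e) : n m / (n <= m)%N >-> (n <= m)%O}.
    move=> n m nm; apply/subsetPset => w [k /andP[t0k kn] h]; exists k => //.
    by rewrite t0k (leq_trans kn)// leq_add2l.
  have {}cv := cv nd.
  rewrite -(cvg_lim _ cv)//; apply: lime_le; first by apply/cvg_ex; exists (P (U t0)).
  apply: nearW => t /=.
  rewrite -[leLHS]fineK ?fin_num_measure// lee_fin ler_pdivlMr// mulrC.
  have [_ h] := maximal_inequality t0 (t0 + t)%N pa e0.
  by apply: le_trans h _; have := hB t; rewrite (s_tail t0) ?leq_addr//; lra.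
have small del : 0 < del -> exists t0, (P (U t0) <= del%:E)%E.
  move=> del0.
  have sup_s : has_sup (range s).
    by split; [exists (s 0%N), 0%N|exists N => _ [m _ <-]].
  have [|_ [t0 _ <-] ht0] := @sup_adherent _ (range s) (del * e) _ sup_s.
    exact: mulr_gt0.
  exists t0; rewrite -[del](mulfK (lt0r_neq0 e0)); apply: PU => t.
  have : s (t0 + t)%N <= sup (range s).
    by apply: ub_le_sup; [case: sup_s|exists (t0 + t)%N].
  by lra.
exists (\bigcap_t0 U t0); split.
- by apply: bigcapT_measurable.
- apply/eqP; rewrite eq_le measure_ge0 andbT.
  apply/lee_addgt0Pr => del del0; rewrite add0e.
  have [t0 ht0] := small del del0.
  apply: le_trans ht0; apply: le_measure; rewrite ?inE//; first exact: bigcapT_measurable.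
  exact: bigcap_inf.
- move=> w h t0 _; have [m t0m em] := h t0.
  by exists (m - t0)%N => //; exists m; rewrite // t0m subnKC/=.
Qed.

(* Truncation at the level [N] of the quadratic variation reduces square
   summable weights to uniformly square summable ones. *)
Lemma mtransform_cauchy g : (forall t, rmeas_wrt (Fs t) (g t)) ->
  (forall t w, 0 <= g t w <= 1) ->
  {ae P, forall w, (exists N : nat, forall m, \sum_(k < m) g k w ^+ 2 <= N%:R) ->
     forall e, 0 < e -> exists t0, forall m, (t0 <= m)%N ->
       `|mtransform g m w - mtransform g t0 w| <= e}.
Proof.
move=> mg g01.
(* The k-th weight is included: it is known at time k, and without it the truncated sum could
   overshoot N. *)
pose A (N k : nat) := [set w | \sum_(j < k.+1) g j w * g j w <= N%:R].
pose a N k w := g k w * \1_(A N k) w.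
have FA N k : Fs k (A N k).
  apply: rmeas_wrt_le => //; last exact: rmeas_wrt_cst.
  apply: rmeas_wrt_sum => // j _.
  have mj : rmeas_wrt (Fs k) (g j).
    by apply: rmeas_wrt_sub (mg j); apply: filtration_le; rewrite -ltnS.
  exact: rmeas_wrtM.
have pa N : predictable (a N).
  split=> [k|k w]; first by apply: rmeas_wrtM => //; exact: rmeas_wrt_indic.
  rewrite normrM -[leRHS]mulr1; apply: ler_pM => //.
    by have /andP[g0 g1] := g01 k w; rewrite ger0_norm.
  by rewrite indicE; case: (w \in _); rewrite ?normr1 ?normr0.
have aN N m w : \sum_(k < m) a N k w ^+ 2 <= N%:R.
  elim: m => [|m IH]; first by rewrite big_ord0.
  have [Am|nAm] := EM (A N m w); last first.
    by rewrite big_ord_recr /= {2}/a indicE memNset// mulr0 expr0n/= addr0.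
  apply: le_trans Am; apply: ler_sum => k _; rewrite -expr2 /a exprMn.
  by rewrite ler_piMr ?sqr_ge0// indicE; case: (w \in _); rewrite ?expr1n ?expr0n.
have e_gt0 (i : nat) : 0 < i.+1%:R^-1 :> R by rewrite invr_gt0.
(* Countably many levels N and thresholds 1/(i+1) suffice, so the exceptional sets have negligible
   union. *)
apply: (@negligibleS _ _ _ P (\bigcup_N \bigcup_i [set w | forall t0, exists2 m, (t0 <= m)%N &
     i.+1%:R^-1 <= (mtransform (a N) m w - mtransform (a N) t0 w) ^+ 2])); last first.
  apply: negligible_bigcup => N; apply: negligible_bigcup => i.
  exact: fluctuation_negligible (pa N) (aN N) (e_gt0 i).
move=> w /= nw; apply: contrapT => nin; apply: nw => -[N hN] e e0.
pose i := Num.truncn (e ^+ 2)^-1.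
have ie : i.+1%:R^-1 <= e ^+ 2.
  rewrite -[leRHS]invrK lef_pV2 ?posrE ?invr_gt0 ?exprn_gt0//.
  by apply: ltW; exact: truncnS_gt.
have aE k : a N k w = g k w.
  rewrite /a indicE mem_set ?mulr1// /A /=.
  by have := hN k.+1; under eq_bigr do rewrite expr2.
have mE m : mtransform (a N) m w = mtransform g m w.
  by apply: eq_bigr => k _; rewrite aE.
apply: contrapT => /forallNP no; apply: nin; exists N => //; exists i => //= t0.
apply: contrapT => nh; apply: (no t0) => m t0m; rewrite -!mE.
rewrite leNgt; apply/negP => lt_e; apply: nh; exists m => //.
apply: le_trans ie _; rewrite -[leRHS]real_normK ?num_real//.
by rewrite ler_sqr ?nnegrE ?(ltW e0)// (ltW lt_e).
Qed.

End martingale.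

(** With M the noise sum counted from [t0], the difference W - M is a relaxation driven by -M
    instead of the noise, and M is uniformly small. The three thirds are the bound on -M, the
    relaxation error and M itself. *)
Lemma relaxed_noise_vanishes (R : realType) (g xi W : nat -> R) :
  (forall t, 0 <= g t <= 1) -> (forall B, exists m, B <= \sum_(k < m) g k) ->
  (forall e, 0 < e -> exists t0, forall m, (t0 <= m)%N ->
     `|\sum_(k < m) g k * xi k - \sum_(k < t0) g k * xi k| <= e) ->
  (forall t, W t.+1 = (1 - g t) * W t + g t * xi t) ->
  forall e, 0 < e -> exists t0, forall t, (t0 <= t)%N -> `|W t| <= e.
Proof.
move=> g01 gsum cau WS e e0.
have e3 : 0 < e / 3 by rewrite divr_gt0.
have [t0 ht0] := cau _ e3.
pose M t := \sum_(k < t) g k * xi k - \sum_(k < t0) g k * xi k.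
have MS t : M t.+1 = M t + g t * xi t by rewrite /M big_ord_recr/=; ring.
have hM t : (t0 <= t)%N -> - (e / 3) <= M t /\ M t <= e / 3.
  by move=> /ht0; rewrite ler_norml => /andP[].
have up t : (t0 <= t)%N ->
    W t.+1 - M t.+1 <= (1 - g t) * (W t - M t) + g t * (e / 3).
  move=> /hM[l _]; have /andP[g0 _] := g01 t.
  by rewrite WS MS; have := ler_wpM2l g0 l; lra.
have down t : (t0 <= t)%N ->
    M t.+1 - W t.+1 <= (1 - g t) * (M t - W t) + g t * (e / 3).
  move=> /hM[_ u]; have /andP[g0 _] := g01 t.
  by rewrite WS MS; have := ler_wpM2l g0 u; lra.
have [t1 ht1] := @relaxation_le _ g (fun t => W t - M t) _ _ g01 gsum up _ e3.
have [t2 ht2] := @relaxation_le _ g (fun t => M t - W t) _ _ g01 gsum down _ e3.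
exists (maxn t0 (maxn t1 t2)) => t; rewrite !geq_max => /and3P[tt0 tt1 tt2].
have [l u] := hM t tt0; have := ht1 t tt1; have := ht2 t tt2.
by rewrite ler_norml; lra.
Qed.

(** * Convergence *)

Lemma nneseries_pinfty (R : realType) (u : nat -> R) : (forall t, 0 <= u t) ->
  (\sum_(t <oo) (u t)%:E = +oo)%E -> forall B, exists m, B <= \sum_(k < m) u k.
Proof.
move=> u0 uoo B; apply: contrapT => /forallNP no.
have : (\sum_(t <oo) (u t)%:E <= B%:E)%E.
  apply: lime_le; first by apply: is_cvg_nneseries => n _ _; rewrite lee_fin.
  apply: nearW => m; rewrite sumEFin lee_fin big_mkord.
  by have /negP := no m; rewrite -ltNge => /ltW.
by rewrite uoo leye_eq.
Qed.

Lemma nneseries_lt_pinfty (R : realType) (u : nat -> R) : (forall t, 0 <= u t) ->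
  (\sum_(t <oo) (u t)%:E < +oo)%E ->
  exists N : nat, forall m, \sum_(k < m) u k <= N%:R.
Proof.
move=> u0 uoo; have s0 : (0 <= \sum_(t <oo) (u t)%:E)%E.
  by apply: nneseries_ge0 => n _ _; rewrite lee_fin.
have [r rE] : exists r : R, (\sum_(t <oo) (u t)%:E)%E = r%:E.
  by exists (fine (\sum_(t <oo) (u t)%:E)%E); rewrite fineK// ge0_fin_numE.
exists (Num.truncn r).+1 => m; apply: le_trans (ltW (truncnS_gt r)).
rewrite -lee_fin -rE -sumEFin -(big_mkord xpredT (fun k => (u k)%:E)).
by apply: nneseries_lim_ge => n _ _; rewrite lee_fin.
Qed.

Fixpoint relaxed_noise (R : realType) (g xi : nat -> R) (t : nat) : R :=
  match t with
  | 0 => 0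
  | t'.+1 => (1 - g t') * relaxed_noise g xi t' + g t' * xi t'
  end.

Unset Implicit Arguments.

Theorem theorem3p2
  (R : realType) (n : nat) (U V : 'I_n -> finType)
  (p ghat : SA U V -> option 'I_n -> R)
  (Hp0 : forall l j, 0 <= p l j)
  (Hp1 : forall l, \sum_(j : option 'I_n) p l j = 1)
  (Hmodel : SSP_assumption p ghat)
  (d : measure_display) (T : measurableType d) (P : probability T R)
  (Fs : nat -> set (set T))
  (HFsig : forall t, sigma_algebra setT (Fs t))
  (HFmeas : forall t, Fs t `<=` measurable)
  (HFinc : forall t, Fs t `<=` Fs t.+1)
  (gamma : nat -> SA U V -> T -> R)
  (tau : nat -> SA U V -> SA U V -> T -> nat)
  (succ : nat -> SA U V -> T -> option 'I_n)
  (Q : nat -> T -> SA U V -> R)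
  (Hgam01 : forall t l w, 0 <= gamma t l w <= 1)
  (Htau_le : forall t l l' w, (tau t l l' w <= t)%N)
  (Hupd : forall t w l,
     Q t.+1 w l = (1 - gamma t l w) * Q t w l
                  + gamma t l w * (ghat l (succ t l w)
                        + mmval (fun l' => Q (tau t l l' w) w l') (succ t l w)))
  (C1 : forall l, rmeas_wrt (Fs 0%N) (fun w => Q 0%N w l))
  (C2 : forall t l, rmeas_wrt (Fs t) (gamma t l) /\
                    forall l', dmeas_wrt (Fs t) (tau t l l'))
  (C3 : forall t l, dmeas_wrt (Fs t.+1) (succ t l) /\
          forall j, condprob_eq P (Fs t) (succ t l @^-1` [set j]) (p l j))
  (C4 : {ae P, forall w, forall l l' (N : nat), exists t0 : nat,
          forall t, (t0 <= t)%N -> (N <= tau t l l' w)%N})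
  (C5 : {ae P, forall w, forall l,
          (\sum_(t <oo) (gamma t l w)%:E = +oo)%E /\
          (\sum_(t <oo) ((gamma t l w) ^+ 2)%:E < +oo)%E}) :
  (exists! Qs : SA U V -> R, Fop p ghat Qs = Qs) /\
  (forall Qs : SA U V -> R, Fop p ghat Qs = Qs ->
     {ae P, forall w, forall l, (fun t => Q t w l) @ \oo --> Qs l}).
Proof.
have Fmono : shift_monotone (Fop p ghat).
  move=> q q' c c0 qq' l; rewrite !Fop_avg.
  have -> : c = \sum_j p l j * c by rewrite -mulr_suml Hp1 mul1r.
  rewrite -big_split/=; apply: ler_sum => j _; rewrite -mulrDr ler_wpM2l//.
  by rewrite -addrA lerD2l; apply: (mmval_le_shift Hmodel).
have [Y [e' [e'0 FY]]] := Fop_strict_subsolution Hp0 Hp1 Hmodel.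
have [Z [e [e0 FZ]]] := Fop_strict_supersolution Hp0 Hp1 Hmodel.
have [Qa [FQa hQa]] := fixpoint_from_above Fmono e0 FZ e'0 FY.
have [Qb [FQb hQb]] := fixpoint_from_below Fmono e0 FZ e'0 FY.
have uniq (q q' : SA U V -> R) : Fop p ghat q = q -> Fop p ghat q' = q' -> q = q'.
  move=> Fq Fq'; apply/funext => l; apply/eqP; rewrite eq_le.
  by rewrite !(Fop_fixpoint_le Hp0 Hp1 Hmodel).
have {}FQa : Fop p ghat Qa = Qa by exact/funext.
have {}FQb : Fop p ghat Qb = Qb by exact/funext.
split; first by exists Qa; split=> // q; exact: uniq.
move=> Qs FQs.
have QsE : Qs = Qa by exact: uniq.
rewrite (uniq Qb Qs)// in hQb; rewrite -QsE in hQa => {FQa FQb Qa Qb QsE}.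
have FE l j t : Fs t.+1 (succ t l @^-1` [set j]) by have [+ _] := C3 t l; apply.
have p01 l j : 0 <= p l j <= 1.
  by rewrite Hp0 -(Hp1 l) (bigD1 j)//= lerDl sumr_ge0.
(* Indexing by the finite type of pairs lets the almost sure statements be intersected. *)
pose noise_cauchy (lj : SA U V * option 'I_n) (w : T) :=
  (exists N : nat, forall m, \sum_(k < m) gamma k lj.1 w ^+ 2 <= N%:R) ->
  forall e, 0 < e -> exists t0, forall m, (t0 <= m)%N ->
    `|mtransform (fun t => succ t lj.1 @^-1` [set lj.2]) (p lj.1 lj.2) (gamma ^~ lj.1) m w -
      mtransform (fun t => succ t lj.1 @^-1` [set lj.2]) (p lj.1 lj.2) (gamma ^~ lj.1) t0 w| <= e.
have noise : {ae P, forall w, forall lj, noise_cauchy lj w}.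
  apply: (@filter_forall _ _ noise_cauchy _ (ae_filter_ringOfSetsType P)) => -[l j].
  apply: (mtransform_cauchy HFsig HFmeas HFinc (p01 l j) (FE l j)) => //.
  - by move=> t; have [_] := C3 t l; apply.
  - by move=> t; have [] := C2 t l.
move: noise C4 C5; apply: filterS3 => w cau tau_oo gam l.
(* From here on the sample point w is fixed and the argument is deterministic. *)
have gsum l' : forall B, exists m, B <= \sum_(k < m) gamma k l' w.
  apply: (@nneseries_pinfty R (fun t => gamma t l' w)); last by have [] := gam l'.
  by move=> t; have /andP[] := Hgam01 t l' w.
pose W l' j t := relaxed_noise (fun t => gamma t l' w)
  (fun t => (succ t l' w == j)%:R - p l' j) t.
have W0 l' j d' : 0 < d' -> exists t0, forall t, (t0 <= t)%N -> `|W l' j t| <= d'.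
  apply: (@relaxed_noise_vanishes R (fun t => gamma t l' w)
    (fun t => (succ t l' w == j)%:R - p l' j) (W l' j)) => // d'' d''0.
  have [|t0 ht0] := cau (l', j) _ _ d''0.
    apply: (@nneseries_lt_pinfty R (fun t => gamma t l' w ^+ 2)).
      by move=> t; exact: sqr_ge0.
    by have [] := gam l'.
  exists t0 => m t0m; have := ht0 m t0m; rewrite /mtransform /=.
  have E t : \1_(succ t l' @^-1` [set j]) w = (succ t l' w == j)%:R :> R.
    rewrite indicE; congr (_%:R); congr nat_of_bool.
    by apply/idP/eqP => [|h]; [rewrite inE|rewrite inE].
  by under eq_bigr do rewrite E; under [X in _ - X]eq_bigr do rewrite E.
have WS l' j t : W l' j t.+1 = (1 - gamma t l' w) * W l' j t +
    gamma t l' w * ((succ t l' w == j)%:R - p l' j) by [].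
have gw01 t l' : 0 <= gamma t l' w <= 1 by exact: Hgam01.
have taule t l1 l2 : (tau t l1 l2 w <= t)%N by exact: Htau_le.
have QS t l' := Hupd t w l'.
have mmono : shift_monotone (fun (q : SA U V -> R) (j : option 'I_n) => mmval q j).
  by move=> q q' c c0 qq' j; apply: (mmval_le_shift Hmodel).
apply/cvgrPdist_le => eta eta0.
(* Sandwich: by uniqueness both extremal fixed points are [Qs], so a strict supersolution and a
   strict subsolution within eta of it trap the iterates. *)
have [za [da [da0 Fza zaQ]]] := hQa _ eta0.
have [zb [db [db0 Fzb Qzb]]] := hQb _ eta0.
have [t1 ht1] := @eventually_le_supersolution R (SA U V) (option 'I_n)
  (fun t l => gamma t l w) (fun t l l' => tau t l l' w) (fun t l => succ t l w)
  p W gw01 taule gsum tau_oo WS W0 ghat (@mmval R n U V) (fun t => Q t w) za da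
  mmono QS da0 (fun l => etrans (congr1 (fun x => x + da <= za l) (esym (Fop_avg p ghat za l))) (Fza l)).
have [t2 ht2] := @eventually_ge_subsolution R (SA U V) (option 'I_n)
  (fun t l => gamma t l w) (fun t l l' => tau t l l' w) (fun t l => succ t l w)
  p W gw01 taule gsum tau_oo WS W0 ghat (@mmval R n U V) (fun t => Q t w) zb db
  mmono QS db0 (fun l => etrans (congr1 (fun x => zb l + db <= x) (esym (Fop_avg p ghat zb l))) (Fzb l)).
exists (maxn t1 t2) => // t /=; rewrite geq_max => /andP[tt1 tt2].
have := ht1 t tt1 l; have := ht2 t tt2 l; have := zaQ l; have := Qzb l.
by rewrite ler_norml; lra.
Qed.
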